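(* Suppose that $\Lambda_1=\cdots=\Lambda_n=1$ with $n$ odd, that $k\eta\notin\Gamma$ for all odd integers $k$ with $1\le k\le n$, and that $z_i\ne z_j+2\eta\ell\bmod\Gamma$ for $i\neq j$ and $\ell=0,\pm1$. Let $T(z)$ be the transfer matrix acting on the $2^n$-dimensional space of functions on $S=\prod_{i=1}^n\{-z_i-\eta,-z_i+\eta\}$. Then a function $\epsilon(z)$ is a common eigenvalue of the transfer matrices $T(z)$, $z\in\mathbb C$ (i.e. there is a non-zero $u$ with $T(z)u=\epsilon(z)u$ for all $z$), if and only if (i) $\epsilon\in\Theta_n(\chi)$ with $\chi(1)=(-1)^n$, $\chi(\tau)=(-1)^ne^{2\pi i\sum_jz_j}$, and (ii) $\epsilon$ obeys the quadratic relations \[\epsilon(z_i-\eta)\,\epsilon(z_i+\eta)=\prod_{k=1}^n\theta(z_k-z_i+2\eta)\,\theta(z_k-z_i-2\eta),\qquad i=1,\dots,n.\]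
   Context: Let $\mathrm{Im}\,\tau>0$, $\Gamma=\mathbb Z+\tau\mathbb Z$, $\eta\in\mathbb C$, $z_1,\dots,z_n\in\mathbb C$, $\theta(z)=-\sum_{j\in\mathbb Z}\exp(i\pi(j+\frac12)^2\tau+2\pi i(j+\frac12)(z+\frac12))$. For a character $\chi:\Gamma\to\mathbb C^\times$, $\Theta_n(\chi)$ is the space of entire functions $f$ with $f(z+r+s\tau)=\chi(r+s\tau)\exp(-\pi in(s^2\tau+2sz))f(z)$ for all $r,s\in\mathbb Z$. The transfer matrix acts on functions $u:S\to\mathbb C$ by \[T(-z)u(x_1,\dots,x_n)=\sum_{i=1}^n\frac{\theta(\lambda-z+x_i)}{\theta(\lambda)}\prod_{j\ne i}\frac{\theta(z-x_j)}{\theta(x_i-x_j)}\Bigl(\prod_{k=1}^n\theta(x_i+z_k+\eta)\,u(x_1,\dots,x_i-2\eta,\dots,x_n)+\prod_{k=1}^n\theta(x_i+z_k-\eta)\,u(x_1,\dots,x_i+2\eta,\dots,x_n)\Bigr),\] for $x\in S$, where $\lambda=-\sum_{k=1}^n(x_k+z_k)$; terms in which the shifted argument is not in $S$ have coefficient zero and are omitted. (This is $T(z)=b(z)+c(z)$, with $b,c$ the entries of the $E_{\tau,\eta}(sl_2)$ representation by difference operators, restricted to a finite set of points.) *)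

(* Defs.v *)
From HB Require Import structures.
From mathcomp Require Import all_boot all_order all_algebra.
From mathcomp Require Import complex.
From mathcomp Require Import all_classical all_reals all_analysis.

Set Implicit Arguments.
Unset Strict Implicit.
Unset Printing Implicit Defensive.

Import Order.TTheory GRing.Theory Num.Theory.
Import numFieldNormedType.Exports.

Local Open Scope classical_set_scope.
Local Open Scope ring_scope.
Local Open Scope complex_scope.

Section Theta.
Variable R : realType.
Implicit Types (tau z w : R[i]) (f : R[i] -> R[i]) (chi : R[i] -> R[i]).

Definition cexp z : R[i] :=
  (expR (complex.Re z))%:C *
  (cos (complex.Im z) +i* sin (complex.Im z)).

Definition theta_term tau z (j : int) : R[i] :=
  cexp ('i%C * pi%:C * (j%:~R + 2^-1) ^+ 2 * tau
        + 2 * pi%:C * 'i%C * (j%:~R + 2^-1) * (z + 2^-1)).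

(* The sum over j in Z is the sum over j >= 0 plus the sum over j < 0, each the
   limit of its partial sums; [Negz j] is - (j + 1).  The ascription to
   [R[i]^o] selects the usual topology of the complex plane. *)
Definition theta tau z : R[i] :=
  - (limn (series (fun j : nat => theta_term tau z (Posz j) : R[i]^o))
     + limn (series (fun j : nat => theta_term tau z (Negz j) : R[i]^o))).

Definition lattice tau : set R[i] :=
  [set g | exists r s : int, g = r%:~R + s%:~R * tau].

(* A character of the lattice is a function on the whole plane of which only
   the values on the lattice matter. *)
Definition is_character tau chi : Prop :=
  (forall g, lattice tau g -> chi g != 0) /\
  (forall g h, lattice tau g -> lattice tau h -> chi (g + h) = chi g * chi h).

Definition entire f : Prop :=
  forall z, derivable (f : R[i]^o -> R[i]^o) z 1.

Definition Theta tau (n : nat) chi : set (R[i] -> R[i]) :=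
  [set f | entire f /\
    forall (r s : int) z,
      f (z + r%:~R + s%:~R * tau) =
      chi (r%:~R + s%:~R * tau)
      * cexp (- (pi%:C * 'i%C * n%:R
                 * (s%:~R ^+ 2 * tau + 2 * s%:~R * z)))
      * f z].

End Theta.

Section TransferMatrix.
Variables (R : realType) (tau eta : R[i]) (n : nat) (z : 'I_n -> R[i]).

Definition sites : pred {ffun 'I_n -> R[i]} :=
  fun x => [forall i, (x i == - z i - eta) || (x i == - z i + eta)].

Definition site : Type := {x : {ffun 'I_n -> R[i]} | sites x}.

Definition shift_coord (i : 'I_n) (a : R[i]) (x : {ffun 'I_n -> R[i]}) :
    {ffun 'I_n -> R[i]} :=
  [ffun k => if k == i then x k + a else x k].

(* The terms of the transfer matrix whose shifted argument is not a site are
   omitted by extending functions by zero outside the sites. *)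
Definition extend0 (u : site -> R[i]) (y : {ffun 'I_n -> R[i]}) : R[i] :=
  if insub y is Some x then u x else 0.

(* The usual formula gives T(- w); here [transfer z0] is T(z0), with
   w = - z0. *)
Definition transfer (z0 : R[i]) (u : site -> R[i]) (p : site) : R[i] :=
  let w := - z0 in
  let x := val p in
  let lambda := - \sum_k (x k + z k) in
  \sum_i
    theta tau (lambda - w + x i) / theta tau lambda
    * (\prod_(j | j != i) (theta tau (w - x j) / theta tau (x i - x j)))
    * ((\prod_k theta tau (x i + z k + eta)) * extend0 u (shift_coord i (- (2 * eta)) x)
       + (\prod_k theta tau (x i + z k - eta)) * extend0 u (shift_coord i (2 * eta) x)).

Definition common_eigenvalue (eps : R[i] -> R[i]) : Prop :=
  exists2 u : site -> R[i], (exists p, u p != 0) &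
    forall z0 p, transfer z0 u p = eps z0 * u p.

End TransferMatrix.

(* Main.v *)
Require Import Defs.
From HB Require Import structures.
From mathcomp Require Import all_boot all_order all_algebra.
From mathcomp Require Import complex.
From mathcomp Require Import all_classical all_reals all_analysis.
From mathcomp Require Import ring lra zify.

Set Implicit Arguments.
Unset Strict Implicit.
Unset Printing Implicit Defensive.

Import Order.TTheory GRing.Theory Num.Theory.
Import numFieldNormedType.Exports.

Local Open Scope classical_set_scope.
Local Open Scope ring_scope.
Local Open Scope complex_scope.

(** The transfer matrix is an interpolation formula in disguise.  Fix a site
    [x] and let [L_i (w)] be the factor of the i-th summand of [T (w) u (x)]
    that depends on [w].  Each [L_i] lies in the space of theta functions of
    degree [n] with the character of the statement, and
    [L_i (- x_j) = delta_ij].  This uses that [theta] vanishes at 0 and that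
    [theta lambda] and [theta (x_i - x_j)] are nonzero, which the two
    genericity hypotheses guarantee.

    Suppose [T (w) u = eps (w) u] with [u (x) <> 0].  Dividing by [u (x)] shows
    that [eps] is a combination of the [L_i], hence in the theta space.  Putting [w = - x_i]
    kills all summands but one and leaves, since one of the two shifts has the
    coefficient [theta 0 = 0], a relation between the values of [u] at [x] and
    at the site obtained by flipping the i-th coordinate.  If [x+] and [x-] are
    the two sites, with i-th coordinates [- z_i + eta] and [- z_i - eta], then
    [eps (z_i - eta) u (x+) = a_i u (x-)] and
    [eps (z_i + eta) u (x-) = b_i u (x+)].  Multiplying both gives the
    quadratic relation, because [a_i b_i] is its right-hand side.

    Conversely, the relation is the vanishing of the determinant of this 2 x 2 system,
    so that it has for every [i] a nonzero solution, a function of the i-th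
    coordinate alone.  Let [u] be the product of these functions.  Then
    [T (w) u (x)] is [sum_i eps (- x_i) L_i (w) u (x)], and it remains to see
    that [eps] is interpolated at the [- x_i] by the [L_i].  As the [L_i] are
    linearly independent, this says that the theta space has dimension at most
    [n].

    For that bound, multiply by [exp (- i pi z)] to get functions of period 1
    (here [n] is odd).  The shift by [tau] ties the Fourier coefficient of
    index [m] to that of index [m + n], so that [n] consecutive coefficients
    determine all of them ([fourier_shift]), and a function all of whose
    coefficients vanish is zero ([completeness]).  The first fact needs that a
    Fourier coefficient does not depend on the line along which it is computed;
    since entire means no more than differentiable at every point, this is
    Goursat's theorem ([goursat], [period_integral_const]).

    The remaining input is that [theta] has no zeros outside the lattice
    ([theta_neq0]).  This follows from a finite form of the Jacobi triple
    product ([finite_tripleE]): its left-hand side stays away from 0 when none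
    of its factors vanishes, while its right-hand side tends to 0 with the theta
    series. *)

(** * Complex modulus and complex derivatives *)

Section ComplexPlane.
Variable R : realType.
Local Notation C := R[i].
Local Notation Re := complex.Re.
Local Notation Im := complex.Im.

Definition modulus (z : C) : R := ComplexField.Normc.normc z.

Lemma normE (z : C) : `|z| = (modulus z)%:C.
Proof. by []. Qed.

Lemma modulus0 : modulus 0 = 0.
Proof. exact: ComplexField.Normc.normc0. Qed.

Lemma modulus1 : modulus 1 = 1.
Proof. exact: ComplexField.Normc.normc1. Qed.

Lemma modulusM (x y : C) : modulus (x * y) = modulus x * modulus y.
Proof. exact: ComplexField.Normc.normcM. Qed.

Lemma modulusV (x : C) : modulus x^-1 = (modulus x)^-1.
Proof. exact: ComplexField.Normc.normcV. Qed.

Lemma modulusD (x y : C) : modulus (x + y) <= modulus x + modulus y.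
Proof. exact: le_normcD. Qed.

Lemma modulusN (x : C) : modulus (- x) = modulus x.
Proof. exact: normcN. Qed.

Lemma modulus_sub (x y : C) : modulus (x - y) = modulus (y - x).
Proof. by rewrite -modulusN opprB. Qed.

Lemma modulusX (x : C) k : modulus (x ^+ k) = modulus x ^+ k.
Proof.
by elim: k => [|k IH]; rewrite ?expr0 ?modulus1 // !exprS modulusM IH.
Qed.

Lemma modulus_ge0 (x : C) : 0 <= modulus x.
Proof. by case: x => a b; exact: sqrtr_ge0. Qed.

Lemma modulus_eq0 (x : C) : (modulus x == 0) = (x == 0).
Proof.
apply/eqP/eqP => [|->]; last exact: modulus0.
exact: ComplexField.Normc.eq0_normc.
Qed.

Lemma modulus_gt0 (x : C) : (0 < modulus x) = (x != 0).
Proof. by rewrite lt_def modulus_eq0 modulus_ge0 andbT. Qed.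

Lemma modulus_real (a : R) : modulus a%:C = `|a|.
Proof. by rewrite /modulus /= expr0n /= addr0 sqrtr_sqr. Qed.

Lemma ge_Re (z : C) : `|Re z| <= modulus z.
Proof. by rewrite -lecR -normE; exact: normc_ge_Re. Qed.

Lemma ge_Im (z : C) : `|Im z| <= modulus z.
Proof.
case: z => a b /=; rewrite /modulus /= -sqrtr_sqr ler_wsqrtr //.
by rewrite lerDr sqr_ge0.
Qed.

Lemma modulus_le (z : C) : modulus z <= `|Re z| + `|Im z|.
Proof.
rewrite [X in modulus X]complexE; apply: (le_trans (modulusD _ _)).
rewrite modulus_real lerD2l modulusM modulus_real.
by rewrite /modulus /= expr0n expr1n /= add0r sqrtr1 mul1r.
Qed.

Lemma modulus_sum (I : Type) (r : seq I) (P : pred I) (F : I -> C) :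
  modulus (\sum_(i <- r | P i) F i) <= \sum_(i <- r | P i) modulus (F i).
Proof.
elim/big_rec2: _ => [|i y x _ le_yx]; first by rewrite modulus0.
by apply: (le_trans (modulusD _ _)); rewrite lerD2l.
Qed.

Lemma modulus_prod (I : Type) (r : seq I) (P : pred I) (F : I -> C) :
  modulus (\prod_(i <- r | P i) F i) = \prod_(i <- r | P i) modulus (F i).
Proof.
by elim/big_rec2: _ => [|i y x _ <-]; rewrite ?modulus1 ?modulusM.
Qed.

Lemma gt0_real (e : C) : 0 < e -> e = (Re e)%:C /\ 0 < Re e.
Proof. by case: e => a b; rewrite ltcE /= => /andP[/eqP-> ->]. Qed.

(** Radii and errors are real numbers, for which inequalities are decided by
    linear arithmetic; the order of the complex numbers is only partial. *)
Definition has_cderiv (f : C -> C) (z d : C) : Prop :=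
  forall e : R, 0 < e -> exists2 r : R, 0 < r &
    forall h, modulus h < r -> modulus (f (z + h) - f z - d * h) <= e * modulus h.

Lemma derivable_cderiv (f : C -> C) z :
  derivable (f : C^o -> C^o) z 1 <-> exists d, has_cderiv f z d.
Proof.
split=> [/cvg_ex[d /cvgrPdist_le fd]|[d fd]].
  exists d => e e0.
  have /fd : (0 : C) < e%:C by rewrite ltcR.
  case=> r /= /gt0_real[rR r0] fr.
  exists (Re r) => // h hr.
  have [->|h0] := eqVneq h 0.
    by rewrite addr0 subrr mulr0 subr0 modulus0 mulr0.
  have /fr/(_ h0) : ball_ [eta Num.Def.normr] 0 r h.
    by rewrite /ball_ /= sub0r normrN normE rR ltcR.
  rewrite /= !normE lecR => le_e.
  have -> : f (z + h) - f z - d * h =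
            - (d - h^-1 *: (f (h *: 1 + z) - f z)) * h.
    rewrite /GRing.scale /= mulr1 [h + z]addrC.
    by field.
  by rewrite modulusM modulusN ler_wpM2r // modulus_ge0.
apply/cvg_ex; exists d; apply/cvgrPdist_le => e e0.
have [eR /fd[r r0 fr]] := gt0_real e0.
exists r%:C => /=; first by rewrite ltcR.
move=> h; rewrite /ball_ /= sub0r normrN normE ltcR => hr h0.
have := fr _ hr.
rewrite /= !normE eR lecR.
have -> : f (z + h) - f z - d * h =
          - (d - h^-1 *: (f (h *: 1 + z) - f z)) * h.
  rewrite /GRing.scale /= mulr1 [h + z]addrC.
  by field.
by rewrite modulusM modulusN ler_pM2r // modulus_gt0.
Qed.

End ComplexPlane.

(** * Entire functions and the exponential *)

Section ComplexDerivative.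
Variable R : realType.
Local Notation C := R[i].
Local Notation Re := complex.Re.
Local Notation Im := complex.Im.
Implicit Types (f g : C -> C) (z d : C).

Lemma has_cderiv_affine (a b z : C) : has_cderiv (fun x => a * x + b) z a.
Proof.
move=> e e0; exists 1 => // h _.
rewrite (_ : _ - _ = 0); first by rewrite modulus0 mulr_ge0 ?modulus_ge0 ?ltW.
by ring.
Qed.

Lemma has_cderivD f g z d d' : has_cderiv f z d -> has_cderiv g z d' ->
  has_cderiv (fun x => f x + g x) z (d + d').
Proof.
move=> fd gd e e0; have e2 : 0 < e / 2 by lra.
have [r r0 fr] := fd _ e2; have [r' r'0 gr] := gd _ e2.
exists (Num.min r r'); first by rewrite lt_min r0.
move=> h; rewrite lt_min => /andP[/fr Hf /gr Hg].
rewrite (_ : _ - _ = (f (z + h) - f z - d * h) + (g (z + h) - g z - d' * h));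
  last by ring.
apply: (le_trans (modulusD _ _)); lra.
Qed.

Lemma has_cderiv_lip f z d : has_cderiv f z d -> exists2 r : R, 0 < r &
  forall h, modulus h < r -> modulus (f (z + h) - f z) <= (modulus d + 1) * modulus h.
Proof.
move=> /(_ _ ltr01)[r r0 fr]; exists r => // h /fr H.
rewrite (_ : _ - _ = (f (z + h) - f z - d * h) + d * h); last by ring.
by apply: (le_trans (modulusD _ _)); rewrite modulusM; lra.
Qed.

Lemma has_cderiv_comp f g z d d' : has_cderiv f (g z) d -> has_cderiv g z d' ->
  has_cderiv (fun x => f (g x)) z (d * d').
Proof.
move=> fd gd e e0; have [r1 r10 g1] := has_cderiv_lip gd.
set L := modulus d' + 1 in g1; have L0 : 0 < L.
  by rewrite /L; have := modulus_ge0 d'; lra.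
have [|r2 r20 f2] := fd (e / (2 * L)); first by rewrite divr_gt0 // mulr_gt0.
have D0 : 0 < modulus d + 1 by have := modulus_ge0 d; lra.
have [|r3 r30 g3] := gd (e / (2 * (modulus d + 1))).
  by rewrite divr_gt0 // mulr_gt0.
exists (Num.min r1 (Num.min (r2 / L) r3)).
  by rewrite !lt_min r10 r30 divr_gt0.
move=> h; rewrite !lt_min => /and3P[/g1 H1 h2 /g3 H3].
have H2 : modulus (g (z + h) - g z) < r2.
  by apply: (le_lt_trans H1); rewrite mulrC -ltr_pdivlMr.
have {}H2 := f2 _ H2.
rewrite (_ : g z + (g (z + h) - g z) = g (z + h)) in H2; last by ring.
rewrite (_ : _ - _ = (f (g (z + h)) - f (g z) - d * (g (z + h) - g z))
                     + d * (g (z + h) - g z - d' * h)); last by ring.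
apply: (le_trans (modulusD _ _)); rewrite modulusM.
apply: (@le_trans _ _ (e / (2 * L) * (L * modulus h) +
   (modulus d + 1) * (e / (2 * (modulus d + 1)) * modulus h))).
  apply: lerD.
    by apply: (le_trans H2); rewrite ler_wpM2l // divr_ge0 ?mulr_ge0 // ltW.
  by apply: ler_pM; rewrite ?modulus_ge0 //; lra.
rewrite le_eqVlt; apply/orP; left; apply/eqP; field.
by rewrite !gt_eqF.
Qed.

Lemma entireP f : entire f <-> forall z, exists d, has_cderiv f z d.
Proof. by split=> H z; apply/derivable_cderiv. Qed.

Lemma entire_affine (a b : C) : entire (fun x => a * x + b).
Proof. by apply/entireP => z; exists a; exact: has_cderiv_affine. Qed.

Lemma entire_cst (a : C) : entire (fun=> a).
Proof.
have := @entire_affine 0 a; congr entire.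
by apply/funext => x; rewrite mul0r add0r.
Qed.

Lemma entireD f g : entire f -> entire g -> entire (fun x => f x + g x).
Proof.
move=> /entireP ef /entireP eg; apply/entireP => z.
have [d fd] := ef z; have [d' gd] := eg z.
by exists (d + d'); apply: has_cderivD.
Qed.

Lemma entireM f g : entire f -> entire g -> entire (fun x => f x * g x).
Proof. by move=> ef eg z; exact: derivableM (ef z) (eg z). Qed.

Lemma entire_comp f g : entire f -> entire g -> entire (fun x => f (g x)).
Proof.
move=> /entireP ef /entireP eg; apply/entireP => z.
have [d' gd] := eg z; have [d fd] := ef (g z).
by exists (d * d'); apply: has_cderiv_comp.
Qed.

Lemma entire_sum (I : Type) (r : seq I) (P : pred I) (F : I -> C -> C) :
  (forall i, P i -> entire (F i)) -> entire (fun x => \sum_(i <- r | P i) F i x).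
Proof.
move=> eF; elim: r => [|i r IH].
  have := @entire_cst 0; congr entire; apply/funext => x; exact: esym (big_nil _ _ _ _).
have [Pi|nPi] := boolP (P i).
  have := entireD (eF i Pi) IH; congr entire; apply/funext => x.
  by rewrite big_cons Pi.
by move: IH; congr entire; apply/funext => x; rewrite big_cons (negbTE nPi).
Qed.

Lemma entire_prod (I : Type) (r : seq I) (P : pred I) (F : I -> C -> C) :
  (forall i, P i -> entire (F i)) -> entire (fun x => \prod_(i <- r | P i) F i x).
Proof.
move=> eF; elim: r => [|i r IH].
  have := @entire_cst 1; congr entire; apply/funext => x; exact: esym (big_nil _ _ _ _).
have [Pi|nPi] := boolP (P i).
  have := entireM (eF i Pi) IH; congr entire; apply/funext => x.
  by rewrite big_cons Pi.
by move: IH; congr entire; apply/funext => x; rewrite big_cons (negbTE nPi).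
Qed.

(** Restrictions to real lines are the integrands of the line integrals below. *)
Lemma entire_continuous_line f (a b : C) : entire f ->
  continuous (fun x : R => Re (f (a + x%:C * b))) /\
  continuous (fun x : R => Im (f (a + x%:C * b))).
Proof.
move=> /entireP ef.
have key x (e : R) : 0 < e -> exists2 r : R, 0 < r & forall t, `|x - t| < r ->
    modulus (f (a + x%:C * b) - f (a + t%:C * b)) <= e.
  move=> e0; have [d /has_cderiv_lip[r r0 H]] := ef (a + x%:C * b).
  have B0 : 0 < modulus b + 1 by have := modulus_ge0 b; lra.
  have D0 : 0 < modulus d + 1 by have := modulus_ge0 d; lra.
  exists (Num.min (r / (modulus b + 1)) (e / ((modulus d + 1) * (modulus b + 1)))).
    by rewrite lt_min !divr_gt0 // mulr_gt0.
  move=> t; rewrite lt_min !ltr_pdivlMr ?mulr_gt0 // => /andP[t1 t2].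
  have hE : modulus ((t - x)%:C * b) <= `|x - t| * (modulus b + 1).
    rewrite modulusM modulus_real distrC ler_wpM2l //; lra.
  have := H ((t - x)%:C * b) (le_lt_trans hE t1).
  rewrite (_ : a + x%:C * b + (t - x)%:C * b = a + t%:C * b); last first.
    by rewrite rmorphB /=; ring.
  rewrite modulus_sub => /le_trans; apply.
  apply: le_trans (ltW t2); rewrite [X in _ <= X]mulrCA.
  by rewrite ler_wpM2l // ltW.
split=> x; apply/cvgrPdist_le => e e0; have [r r0 H] := key x _ e0;
  exists r => //= t /H; apply: le_trans.
- by rewrite -raddfB; exact: ge_Re.
- by rewrite -raddfB; exact: ge_Im.
Qed.

Lemma is_derive_littleo (f : R -> R) (x d : R) : is_derive x 1 f d ->
  forall e : R, 0 < e -> exists2 r : R, 0 < r &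
    forall h, `|h| < r -> `|f (x + h) - f x - d * h| <= e * `|h|.
Proof.
move=> [fd fE] e e0; move: fE; rewrite /derive => fE.
have : (h^-1 *: (((f \o shift x) (h *: 1)) - f x) @[h --> 0^']) --> d.
  by rewrite -fE.
move=> /cvgrPdist_le /(_ _ e0)[r /= r0 H]; exists r => // h hr.
have [->|h0] := eqVneq h 0; first by rewrite addr0 subrr mulr0 subrr !normr0 mulr0.
have := H h; rewrite /ball_ /= sub0r normrN => /(_ hr h0).
rewrite (_ : f (x + h) - f x - d * h = - (d - h^-1 *: (f (h *: 1 + x) - f x)) * h).
  by rewrite normrM normrN => ?; rewrite ler_wpM2r.
by rewrite /GRing.scale /= mulr1 [h + x]addrC; field.
Qed.

Lemma cexp0 : cexp (0 : C) = 1.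
Proof. by rewrite /cexp /= expR0 cos0 sin0 mul1r. Qed.

Lemma cexpD (a b : C) : cexp (a + b) = cexp a * cexp b.
Proof.
case: a b => [a a'] [b b']; rewrite /cexp /= expRD cosD sinD.
apply/eqP; rewrite eq_complex /=; apply/andP; split; apply/eqP; ring.
Qed.

Lemma modulus_cexp (a : C) : modulus (cexp a) = expR (Re a).
Proof.
rewrite /cexp modulusM modulus_real ger0_norm ?expR_ge0 //.
by rewrite /modulus /= cos2Dsin2 sqrtr1 mulr1.
Qed.

Lemma cexp_neq0 (a : C) : cexp a != 0.
Proof. by rewrite -modulus_gt0 modulus_cexp expR_gt0. Qed.

Lemma cexpN (a : C) : cexp (- a) = (cexp a)^-1.
Proof.
by apply: (mulIf (cexp_neq0 a)); rewrite -cexpD addNr cexp0 mulVf ?cexp_neq0.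
Qed.

Lemma cexpMn (a : C) n : cexp (n%:R * a) = cexp a ^+ n.
Proof.
elim: n => [|n IH]; first by rewrite mul0r cexp0 expr0.
by rewrite -natr1 mulrDl mul1r cexpD IH exprSr.
Qed.

(** By the addition formula it is enough to differentiate at 0, where the real
    and imaginary parts are products of functions with known real derivatives. *)
Lemma has_cderiv_cexp z : has_cderiv (@cexp R) z (cexp z).
Proof.
have cexp_at0 : has_cderiv (@cexp R) 0 1.
  (* The error is estimated by terms adding up to six times [e / 6 * |h|]. *)
  move=> e e0; have e6 : 0 < e / 6 by lra.
  have [r1 r10 H1] := is_derive_littleo (is_derive_expR 0) e6.
  have [r2 r20 H2] := is_derive_littleo (is_derive_cos 0) e6.
  have [r3 r30 H3] := is_derive_littleo (is_derive_sin 0) e6.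
  have m0 : 0 < Num.min 1 (e / 6) by rewrite lt_min ltr01.
  have /cvgrPdist_le /(_ _ m0)[r4 /= r40 H4] := @continuous_expR R 0.
  exists (Num.min (Num.min r1 r2) (Num.min r3 r4)); first by rewrite !lt_min r10 r20 r30.
  move=> h; rewrite !lt_min => /andP[/andP[h1 h2] /andP[h3 h4]].
  have ha := ge_Re h; have hb := ge_Im h; set a := Re h in ha; set b := Im h in hb.
  rewrite add0r cexp0 mul1r; apply: (le_trans (modulus_le _)).
  rewrite /cexp -/a -/b {1 2}[h]complexE -/a -/b /=.
  set M := modulus h in ha hb h1 h2 h3 h4 *.
  have {H1} := H1 a (le_lt_trans ha h1).
  have {H2} := H2 b (le_lt_trans hb h2).
  have {H3} := H3 b (le_lt_trans hb h3).
  have {H4} := H4 a; rewrite /= sub0r normrN => /(_ (le_lt_trans ha h4)).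
  rewrite !add0r expR0 cos0 sin0 oppr0 mul0r !subr0 !mul1r addr0 distrC le_min.
  move=> /andP[E1 E2] S Co E.
  rewrite [X in `|X| + _ <= _](_ : _ = (expR a - 1 - a) + expR a * (cos b - 1));
    last by ring.
  rewrite [X in _ + `|X| <= _](_ : _ = expR a * (sin b - b) + (expR a - 1) * b);
    last by ring.
  have E3 : `|expR a| <= 2.
    rewrite (_ : expR a = (expR a - 1) + 1); last by ring.
    apply: (le_trans (ler_normD _ _)); rewrite normr1; lra.
  have M1 : `|expR a * (cos b - 1)| <= 2 * (e / 6 * M).
    by rewrite normrM; apply: ler_pM => //; apply: (le_trans Co); rewrite ler_pM2l.
  have M2 : `|expR a * (sin b - b)| <= 2 * (e / 6 * M).
    by rewrite normrM; apply: ler_pM => //; apply: (le_trans S); rewrite ler_pM2l.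
  have M3 : `|(expR a - 1) * b| <= e / 6 * M by rewrite normrM; apply: ler_pM.
  have M4 : `|expR a - 1 - a| <= e / 6 * M.
    by apply: (le_trans E); rewrite ler_pM2l.
  have := ler_normD (expR a - 1 - a) (expR a * (cos b - 1)).
  have := ler_normD (expR a * (sin b - b)) ((expR a - 1) * b).
  lra.
move=> e e0; have c0 : 0 < modulus (cexp z) by rewrite modulus_gt0 cexp_neq0.
have [|r r0 H] := cexp_at0 (e / modulus (cexp z)); first by rewrite divr_gt0.
exists r => // h /H; rewrite add0r cexp0 mul1r cexpD.
rewrite (_ : cexp z * cexp h - cexp z - cexp z * h = cexp z * (cexp h - 1 - h)).
  rewrite modulusM => H1; rewrite -ler_pdivlMl //; apply: (le_trans H1).
  by rewrite mulrA [(_^-1) * e]mulrC.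
by ring.
Qed.

Lemma entire_cexp : entire (@cexp R).
Proof. by apply/entireP => z; exists (cexp z); exact: has_cderiv_cexp. Qed.

End ComplexDerivative.

(* The predicate [entire] unfolds to a product, whose bound variables must not
   become implicit arguments. *)
Arguments entire_affine : clear implicits.
Arguments entire_affine {R} a b.
Arguments entire_cst : clear implicits.
Arguments entire_cst {R} a.
Arguments entire_cexp : clear implicits.
Arguments entire_cexp {R}.
Arguments entireD : clear implicits.
Arguments entireD {R f g} _ _.
Arguments entireM : clear implicits.
Arguments entireM {R f g} _ _.
Arguments entire_comp : clear implicits.
Arguments entire_comp {R f g} _ _.
Arguments entire_sum : clear implicits.
Arguments entire_sum {R I r P F} _.
Arguments entire_prod : clear implicits.
Arguments entire_prod {R I r P F} _.

(** * Real integrals through primitives *)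

Section Integral.
Variable R : realType.
Local Notation C := R[i].
Local Notation Re := complex.Re.
Local Notation Im := complex.Im.
Local Notation mu := (@lebesgue_measure R).

Lemma MVT_half_line (F dF : R -> R) (a b : R) : a <= b ->
  (forall x, a <= x -> is_derive x 1 F (dF x)) ->
  exists2 c, a <= c <= b & F b - F a = dF c * (b - a).
Proof.
move=> ab Fd; have [||c] := @MVT_segment R F dF a b ab.
- by move=> x; rewrite in_itv /= => /andP[ax _]; apply: Fd; exact: ltW.
- apply: continuous_in_subspaceT => x; rewrite inE /= in_itv /= => /andP[ax _].
  by apply: differentiable_continuous; apply/derivable1_diffP; case: (Fd x ax).
by rewrite in_itv /= => cab E; exists c.
Qed.

(** The base point -1 makes this a primitive on a neighbourhood of the half-line
    of nonnegative reals, which contains all the intervals of integration. *)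
Definition primitive (phi : R -> R) (x : R) : R := \int[mu]_(t in `[-1, x]) phi t.

Lemma primitive_deriv (phi : R -> R) (x : R) : continuous phi -> 0 <= x ->
  is_derive x 1 (primitive phi) (phi x).
Proof.
move=> cphi x0; have [||||D E] := @continuous_FTC1_closed R phi (-1) x (x + 1).
- lra.
- apply: continuous_compact_integrable; first exact: segment_compact.
  exact: continuous_subspaceT.
- lra.
- exact: cphi.
by apply: DeriveDef; [exact: D|rewrite -derive1E; exact: E].
Qed.

(** Defining the integral as the increment of a primitive makes additivity in
    the interval trivial and reduces all other properties to the mean value
    theorem. *)
Definition rint (phi : R -> R) (a b : R) : R := primitive phi b - primitive phi a.

Lemma rint_ftc (phi F : R -> R) (a b : R) : continuous phi -> 0 <= a <= b ->
  (forall x, a <= x -> is_derive x 1 F (phi x)) -> rint phi a b = F b - F a.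
Proof.
move=> cphi /andP[a0 ab] Fd.
have [x ax|c _] := @MVT_half_line (fun x => F x - primitive phi x) (fun=> 0) a b ab.
  have H1 := Fd x ax; have H2 := primitive_deriv cphi (le_trans a0 ax).
  by apply: is_derive_eq; rewrite subrr.
by rewrite mul0r /rint => E; lra.
Qed.

Lemma rint_le (phi psi : R -> R) (a b : R) : continuous phi -> continuous psi ->
  0 <= a <= b -> (forall x, a <= x <= b -> phi x <= psi x) ->
  rint phi a b <= rint psi a b.
Proof.
move=> cphi cpsi /andP[a0 ab] le_phi.
have [x ax|c /le_phi cab] := @MVT_half_line (fun x => primitive psi x - primitive phi x)
  (fun x => psi x - phi x) a b ab.
  have H1 := primitive_deriv cpsi (le_trans a0 ax).
  have H2 := primitive_deriv cphi (le_trans a0 ax).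
  by apply: is_derive_eq.
rewrite /rint => E.
have : 0 <= (psi c - phi c) * (b - a) by rewrite mulr_ge0 ?subr_ge0.
lra.
Qed.

Lemma rint_cst (k a b : R) : 0 <= a <= b -> rint (fun=> k) a b = k * (b - a).
Proof.
move=> ab; have D x : a <= x -> is_derive x 1 (fun x => k * x) k.
  by move=> _; apply: is_derive_eq; rewrite /GRing.scale /=; ring.
by rewrite (rint_ftc _ ab D) ?mulrBr //; exact: cst_continuous.
Qed.

Lemma rint_linear (k : R) (phi psi : R -> R) (a b : R) :
  continuous phi -> continuous psi -> 0 <= a <= b ->
  rint (fun x => k * phi x + psi x) a b = k * rint phi a b + rint psi a b.
Proof.
move=> cphi cpsi /andP[a0 ab].
have D x : a <= x -> is_derive x 1
    (fun x => k * primitive phi x + primitive psi x) (k * phi x + psi x).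
  move=> ax; have H1 := primitive_deriv cphi (le_trans a0 ax).
  have H2 := primitive_deriv cpsi (le_trans a0 ax).
  by apply: is_derive_eq; rewrite /GRing.scale /=; ring.
rewrite (rint_ftc _ _ D) ?a0 //; first by rewrite /rint; ring.
move=> x; apply: cvgD; last exact: cpsi.
by apply: cvgM; [exact: cvg_cst|exact: cphi].
Qed.

End Integral.

(** * Complex line integrals *)

Section ComplexIntegral.
Variable R : realType.
Local Notation C := R[i].
Local Notation Re := complex.Re.
Local Notation Im := complex.Im.

Definition ccontinuous (phi : R -> C) : Prop :=
  continuous (fun x => Re (phi x)) /\ continuous (fun x => Im (phi x)).

Definition cint (phi : R -> C) (a b : R) : C :=
  rint (fun x => Re (phi x)) a b +i* rint (fun x => Im (phi x)) a b.

Lemma ReM (x y : C) : Re (x * y) = Re x * Re y - Im x * Im y.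
Proof. by case: x y => [a b] [c d]. Qed.

Lemma ImM (x y : C) : Im (x * y) = Re x * Im y + Im x * Re y.
Proof. by case: x y => [a b] [c d]. Qed.

Lemma ReZ (a : R) (x : C) : Re (a%:C * x) = a * Re x.
Proof. by rewrite ReM /= mul0r subr0. Qed.

Lemma ImZ (a : R) (x : C) : Im (a%:C * x) = a * Im x.
Proof. by rewrite ImM /= mul0r addr0. Qed.

Lemma realCV (a : R) : (a^-1)%:C = (a%:C)^-1 :> C.
Proof. exact: fmorphV. Qed.

Lemma complex_eq (x y : C) : Re x = Re y -> Im x = Im y -> x = y.
Proof. by case: x y => [a b] [c d] /= -> ->. Qed.

Lemma ccontinuousD (phi psi : R -> C) : ccontinuous phi -> ccontinuous psi ->
  ccontinuous (fun x => phi x + psi x).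
Proof.
move=> [c1 c2] [d1 d2]; split.
  rewrite (_ : (fun x => _) = (fun x => Re (phi x) + Re (psi x))).
    by move=> x; apply: cvgD; [exact: c1|exact: d1].
  by apply/funext => x; rewrite raddfD.
rewrite (_ : (fun x => _) = (fun x => Im (phi x) + Im (psi x))).
  by move=> x; apply: cvgD; [exact: c2|exact: d2].
by apply/funext => x; rewrite raddfD.
Qed.

Lemma ccontinuousM (phi psi : R -> C) : ccontinuous phi -> ccontinuous psi ->
  ccontinuous (fun x => phi x * psi x).
Proof.
move=> [c1 c2] [d1 d2]; split.
  rewrite (_ : (fun x => _) = (fun x => Re (phi x) * Re (psi x) - Im (phi x) * Im (psi x))).
    move=> x; apply: cvgB; apply: cvgM; [exact: c1|exact: d1|exact: c2|exact: d2].
  by apply/funext => x; rewrite ReM.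
rewrite (_ : (fun x => _) = (fun x => Re (phi x) * Im (psi x) + Im (phi x) * Re (psi x))).
  move=> x; apply: cvgD; apply: cvgM; [exact: c1|exact: d2|exact: c2|exact: d1].
by apply/funext => x; rewrite ImM.
Qed.

Lemma ccontinuous_cst (k : C) : ccontinuous (fun=> k).
Proof. by split; exact: cst_continuous. Qed.

Lemma cint_linear (k : C) (phi psi : R -> C) (a b : R) :
  ccontinuous phi -> ccontinuous psi -> 0 <= a <= b ->
  cint (fun x => k * phi x + psi x) a b = k * cint phi a b + cint psi a b.
Proof.
move=> [c1 c2] [d1 d2] ab; rewrite /cint; apply: complex_eq; rewrite raddfD /=.
  rewrite ReM /= -addrA -mulNr -!rint_linear //.
    by congr rint; apply/funext => x; rewrite raddfD /= ReM; ring.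
  move=> x; apply: cvgD; last exact: d1.
  by apply: cvgM; [exact: cvg_cst|exact: c2].
rewrite ImM /= -addrA -!rint_linear //.
  by congr rint; apply/funext => x; rewrite raddfD /= ImM; ring.
move=> x; apply: cvgD; last exact: d2.
by apply: cvgM; [exact: cvg_cst|exact: c1].
Qed.

Lemma cint0 (a b : R) : 0 <= a <= b -> cint (fun=> 0) a b = 0.
Proof. by move=> ab; rewrite /cint /= rint_cst // mul0r. Qed.

Lemma cintZ (k : C) (phi : R -> C) (a b : R) :
  ccontinuous phi -> 0 <= a <= b ->
  cint (fun x => k * phi x) a b = k * cint phi a b.
Proof.
move=> cphi ab; rewrite -[RHS]addr0 -(cint0 ab) -cint_linear //.
  by congr cint; apply/funext => x; rewrite addr0.
exact: ccontinuous_cst.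
Qed.

Lemma cint_cat (phi : R -> C) (a b c : R) :
  cint phi a b + cint phi b c = cint phi a c.
Proof.
apply: complex_eq; rewrite raddfD /= /rint; ring.
Qed.

(** The factor 2 comes from bounding the real and imaginary parts separately. *)
Lemma cint_bound (phi : R -> C) (a b M : R) : ccontinuous phi -> 0 <= a <= b ->
  (forall x, a <= x <= b -> modulus (phi x) <= M) ->
  modulus (cint phi a b) <= 2 * M * (b - a).
Proof.
move=> [c1 c2] ab leM.
have key (psi : R -> R) : continuous psi ->
    (forall x, a <= x <= b -> `|psi x| <= M) -> `|rint psi a b| <= M * (b - a).
  move=> cpsi lepsi; rewrite ler_norml -mulNr -!rint_cst //.
  by apply/andP; split; apply: rint_le => //;
    try exact: cst_continuous; move=> x /lepsi; rewrite ler_norml => /andP[].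
apply: (le_trans (modulus_le _)) => /=.
have := key _ c1 (fun x xab => le_trans (ge_Re _) (leM x xab)).
have := key _ c2 (fun x xab => le_trans (ge_Im _) (leM x xab)).
lra.
Qed.

Lemma is_derive_line (f : C -> C) (p v d : C) (t : R) :
  has_cderiv f (p + t%:C * v) d ->
  is_derive t 1 (fun t => Re (f (p + t%:C * v))) (Re (d * v)) /\
  is_derive t 1 (fun t => Im (f (p + t%:C * v))) (Im (d * v)).
Proof.
move=> fd.
have key (e : R) : 0 < e -> exists2 r : R, 0 < r & forall h, `|h| < r -> h != 0 ->
    modulus (d * v - (h%:C)^-1 * (f (p + (h + t)%:C * v) - f (p + t%:C * v))) <= e.
  move=> e0; have V0 : 0 < modulus v + 1 by have := modulus_ge0 v; lra.
  have [|r r0 fr] := fd (e / (modulus v + 1)); first by rewrite divr_gt0.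
  exists (r / (modulus v + 1)); first by rewrite divr_gt0.
  move=> h; rewrite ltr_pdivlMr // => hr h0.
  have hC : h%:C != 0 :> C by rewrite -(rmorph0 (real_complex R)) (inj_eq (@complexI R)).
  have Hv : modulus (h%:C * v) <= `|h| * (modulus v + 1).
    by rewrite modulusM modulus_real ler_wpM2l //; lra.
  have := fr (h%:C * v) (le_lt_trans Hv hr).
  rewrite (_ : p + t%:C * v + h%:C * v = p + (h + t)%:C * v); last first.
    by rewrite rmorphD /=; ring.
  set D := f (p + (h + t)%:C * v) - _.
  rewrite (_ : D - d * (h%:C * v) = - h%:C * (d * v - h%:C^-1 * D)); last by field.
  rewrite (modulusM (- _)) modulusN modulus_real => H.
  have {H} := le_trans H (ler_wpM2l (ltW (divr_gt0 e0 V0)) Hv).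
  rewrite mulrCA divfK ?gt_eqF // ler_pM2l // normr_gt0 //.
have toD (F : R -> R) l : (h^-1 *: ((F \o shift t) (h *: 1) - F t) @[h --> 0^'] --> l) ->
    is_derive t 1 F l.
  by move=> H; apply: DeriveDef; [apply/cvg_ex; exists l|exact: cvg_lim H].
split; apply: toD; apply/cvgrPdist_le => e /key[r r0 H]; exists r => // h;
  rewrite /ball_ /= sub0r normrN => hr h0; apply: le_trans (H h hr h0).
- apply: le_trans (ge_Re _); rewrite le_eqVlt; apply/orP; left; apply/eqP.
  congr `|_|; rewrite [RHS]raddfB; congr (_ - _).
  by rewrite /= -realCV ReZ [in RHS]raddfB /GRing.scale /= mulr1.
- apply: le_trans (ge_Im _); rewrite le_eqVlt; apply/orP; left; apply/eqP.
  congr `|_|; rewrite [RHS]raddfB; congr (_ - _).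
  by rewrite /= -realCV ImZ [in RHS]raddfB /GRing.scale /= mulr1.
Qed.

(** The integral of [g] along the segment from [p + a v] to [p + b v]. *)
Definition seg (g : C -> C) (p v : C) (a b : R) : C :=
  v * cint (fun t => g (p + t%:C * v)) a b.

Lemma seg_cat g p v a b c : seg g p v a b + seg g p v b c = seg g p v a c.
Proof. by rewrite -mulrDr cint_cat. Qed.

Lemma seg_ftc (f g : C -> C) (p v : C) (a b : R) :
  ccontinuous (fun t => g (p + t%:C * v)) -> 0 <= a <= b ->
  (forall z, has_cderiv f z (g z)) ->
  seg g p v a b = f (p + b%:C * v) - f (p + a%:C * v).
Proof.
move=> cg ab fg; rewrite /seg -cintZ //.
have [cR cI] := ccontinuousM (ccontinuous_cst v) cg.
have D t : a <= t -> is_derive t 1 (fun t => Re (f (p + t%:C * v)))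
                                 (Re (v * g (p + t%:C * v))).
  by move=> _; rewrite [v * _]mulrC; exact: (is_derive_line (fg _)).1.
have D' t : a <= t -> is_derive t 1 (fun t => Im (f (p + t%:C * v)))
                                  (Im (v * g (p + t%:C * v))).
  by move=> _; rewrite [v * _]mulrC; exact: (is_derive_line (fg _)).2.
apply: complex_eq => /=.
  by rewrite (rint_ftc cR ab D) raddfB.
by rewrite (rint_ftc cI ab D') raddfB.
Qed.

Lemma entire_ccontinuous (g : C -> C) (p v : C) : entire g ->
  ccontinuous (fun t => g (p + t%:C * v)).
Proof. exact: entire_continuous_line. Qed.

Lemma seg_bound (g : C -> C) (p v : C) (a b M : R) : entire g -> 0 <= a <= b ->
  (forall t, a <= t <= b -> modulus (g (p + t%:C * v)) <= M) ->
  modulus (seg g p v a b) <= modulus v * (2 * M * (b - a)).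
Proof.
move=> eg ab leM; rewrite /seg modulusM ler_wpM2l ?modulus_ge0 //.
by apply: cint_bound => //; exact: entire_ccontinuous.
Qed.

Lemma segD (f g : C -> C) (p v : C) (a b : R) : entire f -> entire g ->
  0 <= a <= b ->
  seg (fun z => f z + g z) p v a b = seg f p v a b + seg g p v a b.
Proof.
move=> ef eg ab; rewrite /seg -mulrDr; congr (_ * _).
rewrite -[cint _ a b in RHS]mul1r -cint_linear //; try exact: entire_ccontinuous.
by congr cint; apply/funext => t; rewrite mul1r.
Qed.

End ComplexIntegral.

(** * Goursat's theorem *)

Section Goursat.
Variable R : realType.
Local Notation C := R[i].

Lemma half_pow_lt (e : R) : 0 < e -> exists k : nat, 2^-1 ^+ k < e.
Proof.
move=> e0; have e1 : 0 < e^-1 by rewrite invr_gt0.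
set k := Num.truncn e^-1; exists k.+1.
have h1 : e^-1 < k.+1%:R by have := truncn_itv (ltW e1) => /andP[].
have h2 : (k.+1%:R : R) <= 2 ^+ k.+1 by rewrite -natrX ler_nat ltnW // ltn_expl.
rewrite exprVn invf_plt ?posrE ?exprn_gt0 //; exact: lt_le_trans h1 h2.
Qed.

(** Bolzano's nested squares: a property that passes from a square to one of its
    quarters holds on arbitrarily small squares around some point. *)
Lemma bisection (P : R -> R -> R -> Prop) :
  (forall a c w, 0 <= a -> 0 <= c -> 0 < w -> P a c w -> exists a' c',
     [/\ a' = a \/ a' = a + w / 2, c' = c \/ c' = c + w / 2 & P a' c' (w / 2)]) ->
  P 0 0 1 ->
  exists x0 s0, forall d : R, 0 < d -> exists a c w,
    [/\ 0 <= a <= x0 /\ x0 <= a + w, 0 <= c <= s0 /\ s0 <= c + w, 0 < w < d & P a c w].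
Proof.
move=> split_sq P0.
pose good (t : R * R * R) := [/\ 0 <= t.1.1, 0 <= t.1.2, 0 < t.2 & P t.1.1 t.1.2 t.2].
pose step (t t' : R * R * R) := [/\ t'.1.1 = t.1.1 \/ t'.1.1 = t.1.1 + t.2 / 2,
  t'.1.2 = t.1.2 \/ t'.1.2 = t.1.2 + t.2 / 2 & t'.2 = t.2 / 2].
have [next nextP] : {next : R * R * R -> R * R * R &
    forall t, good t -> step t (next t) /\ good (next t)}.
  apply: (@choice _ _ (fun t t' => good t -> step t t' /\ good t')) => t.
  have [[a0 c0 w0 Pt]|] := pselect (good t); last by exists t.
  have [a' [c' [ha hc Pt']]] := split_sq _ _ _ a0 c0 w0 Pt.
  exists (a', c', t.2 / 2) => _; split=> //; split=> //=; last by lra.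
    by case: ha => ->; lra.
  by case: hc => ->; lra.
pose u k := iter k next (0, 0, 1).
have good_u k : good (u k).
  by elim: k => [|k IH]; [split=> //=; lra|exact: (nextP _ IH).2].
have step_u k : step (u k) (u k.+1) by exact: (nextP _ (good_u k)).1.
have wE k : (u k).2 = 2^-1 ^+ k.
  by elim: k => [//|k IH]; have [_ _ ->] := step_u k; rewrite IH exprSr.
have lim_point (f : nat -> R) :
    (forall k, f k.+1 = f k \/ f k.+1 = f k + (u k).2 / 2) ->
    exists x, forall k, f k <= x <= f k + (u k).2.
  move=> fstep.
  have fup k m : f k <= f (k + m)%N.
    elim: m => [|m IH]; first by rewrite addn0.
    rewrite addnS; have [_ _ w0 _] := good_u (k + m)%N.
    by case: (fstep (k + m)%N) => ->; lra.
  have fdn k m : f (k + m)%N + (u (k + m)%N).2 <= f k + (u k).2.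
    elim: m => [|m IH]; first by rewrite addn0.
    rewrite addnS; have [_ _ w0 _] := good_u (k + m)%N.
    have [_ _ ->] := step_u (k + m)%N.
    by case: (fstep (k + m)%N) => ->; lra.
  have ub j k : f j <= f k + (u k).2.
    have [le_kj|/ltnW le_jk] := leqP k j.
      have := fdn k (j - k)%N; rewrite subnKC //.
      by have [_ _ w0 _] := good_u j; lra.
    have := fup j (k - j)%N; rewrite subnKC //.
    by have [_ _ w0 _] := good_u k; lra.
  exists (sup (range f)) => k; apply/andP; split.
    apply: ub_le_sup; last by exists k.
    by exists (f 0%N + (u 0%N).2) => _ [j _ <-].
  by apply: ge_sup; [exists (f 0%N), 0%N|move=> _ [j _ <-]].
have [x0 x0P] : exists x, forall k, (u k).1.1 <= x <= (u k).1.1 + (u k).2.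
  by apply: (lim_point (fun k => (u k).1.1)) => k; case: (step_u k).
have [s0 s0P] : exists x, forall k, (u k).1.2 <= x <= (u k).1.2 + (u k).2.
  by apply: (lim_point (fun k => (u k).1.2)) => k; case: (step_u k).
exists x0, s0 => d /half_pow_lt[k kd]; exists (u k).1.1, (u k).1.2, (u k).2.
have [a0 c0 w0 Pk] := good_u k.
have /andP[x1 x2] := x0P k; have /andP[s1 s2] := s0P k.
by split; [split=> //; apply/andP|split=> //; apply/andP|rewrite w0 wE|].
Qed.

Variables (g : C -> C) (zeta v : C).
Hypothesis eg : entire g.

(** The integral around the parallelogram with corner [zeta + a + c v] and sides
    [w] and [w v]. *)
Definition boundary (g : C -> C) (a c w : R) : C :=
  seg g (zeta + c%:C * v) 1 a (a + w) + seg g (zeta + (a + w)%:C) v c (c + w)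
  - seg g (zeta + (c + w)%:C * v) 1 a (a + w) - seg g (zeta + a%:C) v c (c + w).

(** The integrals over the interior sides of the four quarters cancel. *)
Lemma boundary_split (a c w : R) :
  boundary g a c w = boundary g a c (w / 2) + boundary g (a + w / 2) c (w / 2)
    + boundary g a (c + w / 2) (w / 2) + boundary g (a + w / 2) (c + w / 2) (w / 2).
Proof.
have E x : x + w / 2 + w / 2 = x + w by lra.
rewrite /boundary !E.
rewrite -!(@seg_cat _ g _ _ a (a + w / 2) (a + w)).
rewrite -!(@seg_cat _ g _ _ c (c + w / 2) (c + w)).
have alg (A1 A2 B1 B2 C1 C2 D1 D2 E1 E2 F1 F2 : C) :
  A1 + A2 + (B1 + B2) - (C1 + C2) - (D1 + D2) =
  (A1 + E1 - F1 - D1) + (A2 + B1 - F2 - E1) + (F1 + E2 - C1 - D2)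
  + (F2 + B2 - C2 - E2) by ring.
exact: alg.
Qed.

(** An affine function has a global primitive. *)
Lemma boundary_affine (alpha beta : C) (a c w : R) : 0 <= a -> 0 <= c -> 0 < w ->
  boundary (fun z => beta * z + alpha) a c w = 0.
Proof.
move=> a0 c0 w0.
pose A z : C := beta / 2 * z ^+ 2 + alpha * z.
have AD z : has_cderiv A z (beta * z + alpha).
  move=> e e0; have b0 : 0 < modulus (beta / 2) + 1.
    by have := modulus_ge0 (beta / 2); lra.
  exists (e / (modulus (beta / 2) + 1)); first by rewrite divr_gt0.
  move=> h; rewrite ltr_pdivlMr // => hr.
  rewrite (_ : _ - _ = (beta / 2) * h * h); last by rewrite /A; field.
  rewrite modulusM ler_wpM2r ?modulus_ge0 // modulusM mulrC.
  by apply: (le_trans _ (ltW hr)); rewrite ler_wpM2l ?modulus_ge0 //; lra.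
have cont p u : ccontinuous (fun t : R => beta * (p + t%:C * u) + alpha).
  by apply: (@entire_ccontinuous _ (fun z => beta * z + alpha)); exact: entire_affine.
have aw : 0 <= a <= a + w by lra.
have cw : 0 <= c <= c + w by lra.
rewrite /boundary !(@seg_ftc _ A) //.
have swap x y : zeta + x%:C + y%:C * v = zeta + y%:C * v + x%:C * 1 by ring.
by rewrite !swap; set P := A _; set P1 := A _; set P2 := A _; set P3 := A _;
move: P P1 P2 P3 => P P1 P2 P3; ring.
Qed.

Lemma boundaryD (f1 f2 : C -> C) (a c w : R) : entire f1 -> entire f2 ->
  0 <= a -> 0 <= c -> 0 < w ->
  boundary (fun z => f1 z + f2 z) a c w = boundary f1 a c w + boundary f2 a c w.
Proof.
move=> e1 e2 a0 c0 w0.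
have aw : 0 <= a <= a + w by lra.
have cw : 0 <= c <= c + w by lra.
rewrite /boundary !segD //.
have alg (x1 x2 y1 y2 z1 z2 t1 t2 : C) :
  x1 + x2 + (y1 + y2) - (z1 + z2) - (t1 + t2) =
  (x1 + y1 - z1 - t1) + (x2 + y2 - z2 - t2) by ring.
exact: alg.
Qed.

Lemma boundary_bound (f : C -> C) (a c w M : R) : entire f ->
  0 <= a -> 0 <= c -> 0 < w ->
  (forall x s, a <= x <= a + w -> c <= s <= c + w ->
     modulus (f (zeta + x%:C + s%:C * v)) <= M) ->
  modulus (boundary f a c w) <= 4 * M * w * (1 + modulus v).
Proof.
move=> ef a0 c0 w0 leM.
have aw : 0 <= a <= a + w by lra.
have cw : 0 <= c <= c + w by lra.
have H s : c <= s <= c + w ->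
    modulus (seg f (zeta + s%:C * v) 1 a (a + w)) <= 2 * M * w.
  move=> sc; rewrite (_ : 2 * M * w = modulus (1 : C) * (2 * M * (a + w - a)));
    last by rewrite modulus1; ring.
  apply: seg_bound => // t ta; rewrite mulr1 addrAC; exact: leM.
have V x : a <= x <= a + w ->
    modulus (seg f (zeta + x%:C) v c (c + w)) <= modulus v * (2 * M * w).
  move=> xa; rewrite (_ : 2 * M * w = 2 * M * (c + w - c)); last by ring.
  by apply: seg_bound => // t tc; exact: leM.
have cc : c <= c <= c + w by lra.
have cw' : c <= c + w <= c + w by lra.
have aa : a <= a <= a + w by lra.
have aw' : a <= a + w <= a + w by lra.
have tri (x y z t : C) : modulus (x + y - z - t) <=
    modulus x + modulus y + modulus z + modulus t.
  have := modulusD (x + y - z) (- t); have := modulusD (x + y) (- z).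
  have := modulusD x y; rewrite !modulusN; lra.
apply: (le_trans (tri _ _ _ _)).
apply: (le_trans (lerD (lerD (lerD (H _ cc) (V _ aw')) (H _ cw')) (V _ aa))).
by rewrite le_eqVlt; apply/orP; left; apply/eqP; ring.
Qed.

(** Near any point [g] is affine up to an error small against the diameter, so
    its integral around a small square is small against the area. *)
Lemma boundary_small (x0 s0 e : R) : 0 < e -> exists2 d : R, 0 < d &
  forall a c w, 0 <= a <= x0 /\ x0 <= a + w -> 0 <= c <= s0 /\ s0 <= c + w ->
    0 < w < d -> modulus (boundary g a c w) <= e * w ^+ 2.
Proof.
move=> e0; pose z0 := zeta + x0%:C + s0%:C * v.
have [d gd] := (entireP g).1 eg z0.
set D := 1 + modulus v; have D0 : 0 < D by rewrite /D; have := modulus_ge0 v; lra.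
have [|r r0 gr] := gd (e / (4 * D ^+ 2)); first by rewrite divr_gt0 ?mulr_gt0 ?exprn_gt0.
exists (r / D); first by rewrite divr_gt0.
move=> a c w [/andP[a0 ax] xa] [/andP[c0 cs] sc] /andP[w0].
rewrite ltr_pdivlMr // => wr.
pose alpha := g z0 - d * z0.
pose aff z : C := - d * z + - alpha.
have eaff : entire aff := entire_affine (- d) (- alpha).
have er : entire (fun z => g z + aff z) := entireD eg eaff.
have -> : boundary g a c w = boundary (fun z => g z + aff z) a c w.
  by rewrite (boundaryD eg eaff) // boundary_affine // addr0.
have M0 : 0 <= e / (4 * D ^+ 2) by rewrite divr_ge0 ?mulr_ge0 ?exprn_ge0 // ltW.
rewrite (_ : e * w ^+ 2 = 4 * (e / (4 * D ^+ 2) * (w * D)) * w * D); last first.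
  by field; rewrite gt_eqF.
apply: boundary_bound => // x s xw sw.
pose h : C := (x - x0)%:C + (s - s0)%:C * v.
have hw : modulus h <= w * D.
  apply: (le_trans (modulusD _ _)); rewrite modulusM !modulus_real /D mulrDr mulr1.
  apply: lerD; first by rewrite ler_norml; lra.
  by rewrite ler_wpM2r ?modulus_ge0 // ler_norml; lra.
have := gr h (le_lt_trans hw wr).
rewrite (_ : z0 + h = zeta + x%:C + s%:C * v); last first.
  by rewrite /z0 /h !rmorphB /=; ring.
rewrite (_ : g (zeta + x%:C + s%:C * v) - g z0 - d * h =
  g (zeta + x%:C + s%:C * v) + aff (zeta + x%:C + s%:C * v)); last first.
  by rewrite /aff /alpha /z0 /h !rmorphB /=; ring.
by move=> /le_trans; apply; rewrite ler_wpM2l.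
Qed.

(** A nonzero integral around the unit square would give nested squares on which
    the integral is at least a fixed multiple of the area. *)
Lemma goursat : boundary g 0 0 1 = 0.
Proof.
apply/eqP; rewrite -modulus_eq0; apply/negPn/negP => nz.
set K := modulus (boundary g 0 0 1) in nz.
have K0 : 0 < K by rewrite lt_def nz modulus_ge0.
have [a c w a0 c0 w0||x0 [s0 xs]] := @bisection
  (fun a c w => K * w ^+ 2 <= modulus (boundary g a c w)).
- move=> Pw; apply: contrapT => no.
  have small a' c' : a' = a \/ a' = a + w / 2 -> c' = c \/ c' = c + w / 2 ->
      modulus (boundary g a' c' (w / 2)) < K * (w / 2) ^+ 2.
    by move=> ha hc; rewrite ltNge; apply/negP => ?; apply: no; exists a', c'.
  have S1 := small a c (or_introl erefl) (or_introl erefl).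
  have S2 := small (a + w / 2) c (or_intror erefl) (or_introl erefl).
  have S3 := small a (c + w / 2) (or_introl erefl) (or_intror erefl).
  have S4 := small (a + w / 2) (c + w / 2) (or_intror erefl) (or_intror erefl).
  move: Pw; rewrite boundary_split.
  set B1 := boundary g a c _ in S1 *; set B2 := boundary g (a + _) c _ in S2 *.
  set B3 := boundary g a _ _ in S3 *; set B4 := boundary g _ _ _ in S4 *.
  have := modulusD (B1 + B2 + B3) B4; have := modulusD (B1 + B2) B3.
  have := modulusD B1 B2.
  have half2 : (w / 2) ^+ 2 = w ^+ 2 / 4 by field.
  rewrite half2 in S1 S2 S3 S4.
  clearbody B1 B2 B3 B4.
  move: (modulus (B1 + B2 + B3 + B4)) (modulus (B1 + B2 + B3)) (modulus (B1 + B2)) => ? ? ?.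
  lra.
- by rewrite expr1n mulr1.
have [|d d0 sm] := boundary_small x0 s0 (e := K / 2); first by lra.
have [a [c [w [ax cs wd Pw]]]] := xs _ d0.
have := sm _ _ _ ax cs wd.
have : 0 < K * w ^+ 2 by rewrite mulr_gt0 ?exprn_gt0 //; case/andP: wd.
lra.
Qed.

End Goursat.

(** The slanted sides of the parallelogram with corners [p], [p + 1], [q] and
    [q + 1] cancel by periodicity. *)
Lemma period_integral_const (R : realType) (g : R[i] -> R[i]) (p q : R[i]) :
  entire g -> (forall z, g (z + 1) = g z) ->
  cint (fun t => g (p + t%:C)) 0 1 = cint (fun t => g (q + t%:C)) 0 1.
Proof.
move=> eg g1; have := goursat p (q - p) eg.
rewrite /boundary !add0r !rmorph0 !rmorph1 mul0r mul1r !addr0.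
have -> : seg g (p + 1) (q - p) 0 1 = seg g p (q - p) 0 1.
  rewrite /seg; congr (_ * _).
  rewrite (_ : (fun t => g (p + 1 + _)) = (fun t => g (p + t%:C * (q - p)))) //.
  by apply/funext => t; rewrite -[RHS]g1 addrAC.
rewrite addrC; set I := seg g p (q - p) 0 1.
rewrite (_ : p + (q - p) = q); last by ring.
set X := seg g p 1 0 1; set Y := seg g q 1 0 1.
have alg : - I + (X + I - Y) = X - Y by ring.
rewrite alg => /eqP; rewrite subr_eq0 => /eqP.
rewrite /X /Y /seg !mul1r.
have E r : (fun t => g (r + t%:C * 1)) = (fun t : R => g (r + t%:C)).
  by apply/funext => t; rewrite mulr1.
by rewrite !E.
Qed.

(** * Completeness of the exponentials *)

Section Completeness.
Variable R : realType.
Local Notation C := R[i].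
Local Notation Re := complex.Re.
Local Notation Im := complex.Im.

(** The coordinate [exp (2 pi i z)] of the cylinder of complex numbers modulo 1. *)
Definition expi (z : C) : C := cexp (2 * pi%:C * 'i%C * z).

Lemma expiE z : expi z = cexp (2 * pi%:C * 'i%C * z).
Proof. by []. Qed.

Lemma expiD a b : expi (a + b) = expi a * expi b.
Proof. by rewrite /expi mulrDr cexpD. Qed.

Lemma expi0 : expi 0 = 1.
Proof. by rewrite /expi mulr0 cexp0. Qed.

Lemma expiN a : expi (- a) = (expi a)^-1.
Proof. by rewrite /expi mulrN cexpN. Qed.

Lemma expi_neq0 a : expi a != 0.
Proof. exact: cexp_neq0. Qed.

Lemma expi_real (t : R) : expi t%:C = cos (2 * pi * t) +i* sin (2 * pi * t).
Proof.
rewrite /expi (_ : 2 * pi%:C * 'i%C * t%:C = 0 +i* (2 * pi * t)).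
  by rewrite /cexp /= expR0 mul1r.
rewrite (_ : 2 * pi%:C * 'i%C * t%:C = (2 * pi * t)%:C * 'i%C); last first.
  by rewrite !rmorphM /= rmorph_nat; ring.
by apply: complex_eq; rewrite ?ReZ ?ImZ /= ?mulr0 ?mulr1.
Qed.

Lemma expi1 : expi 1 = 1.
Proof.
rewrite -(rmorph1 (real_complex R)) expi_real mulr1 mulr_natl cos2pi sin2pi.
by [].
Qed.

Lemma cexp_pi : cexp ('i%C * pi%:C) = -1 :> C.
Proof.
rewrite (_ : 'i%C * pi%:C = 2 * pi%:C * 'i%C * (2^-1)%:C); last first.
  by rewrite fmorphV rmorph_nat; field.
rewrite -expiE expi_real (_ : 2 * pi * 2^-1 = pi); last by field.
by rewrite cospi sinpi; apply: complex_eq => //=; rewrite oppr0.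
Qed.

Lemma expi_int (m : int) : expi m%:~R = 1.
Proof.
have nat_case n : expi n%:R = 1.
  by elim: n => [|n IH]; rewrite ?expi0 // -natr1 expiD IH expi1 mulr1.
case: m => n; first exact: nat_case.
by rewrite NegzE mulrNz expiN nat_case invr1.
Qed.

Lemma entire_expi (k : C) : entire (fun z => expi (k * z)).
Proof.
apply: (@entire_comp _ (@cexp R) (fun z => 2 * pi%:C * 'i%C * (k * z))).
  exact: entire_cexp.
rewrite (_ : (fun z => _) = (fun z => (2 * pi%:C * 'i%C * k) * z + 0)).
  exact: entire_affine.
by apply/funext => z; ring.
Qed.

Arguments entire_expi : clear implicits.

Lemma expi_ccontinuous (k : C) : ccontinuous (fun t : R => expi (k * t%:C)).
Proof.
have -> : (fun t : R => expi (k * t%:C)) =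
          (fun t : R => (fun z => expi (k * z)) (0 + t%:C * 1)).
  by apply/funext => t /=; rewrite add0r mulr1.
exact: entire_ccontinuous (entire_expi k).
Qed.

Let q (t : R) : R := (1 - cos (2 * pi * t)) / 2.

Let q_sym t : q (1 - t) = q t.
Proof.
rewrite /q (_ : 2 * pi * (1 - t) = - (2 * pi * t) + pi *+ 2); last by ring.
by rewrite cosD2pi cosN.
Qed.

Let q_lt s t : 0 <= s -> s < t -> t <= 2^-1 -> q s < q t.
Proof.
move=> s0 st t2; have p0 := pi_gt0 R.
have in0pi u : 0 <= u -> u <= 2^-1 -> 2 * pi * u \in `[0, pi :> R].
  move=> u0 u2; rewrite in_itv /= !mulr_ge0 ?pi_ge0 //=.
  by rewrite mulrAC -[leRHS]mul1r ler_pM2r //; lra.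
rewrite /q ltr_pM2r ?invr_gt0 // ltrD2l ltrN2 ltr_cos ?in0pi //; try lra.
by rewrite ltr_pM2l // mulr_gt0.
Qed.

Let q_le s t : 0 <= s -> s <= t -> t <= 2^-1 -> q s <= q t.
Proof.
move=> s0; rewrite le_eqVlt => /orP[/eqP->//|st] t2.
by apply/ltW/q_lt.
Qed.

Let q_ge0 t : 0 <= q t.
Proof. by rewrite /q divr_ge0 // subr_ge0 cos_le1. Qed.

Let qC (t : R) : C := 2^-1 + (- 4^-1 * expi (1 * t%:C) + (- 4^-1 * expi (-1 * t%:C))).

Let qCE t : qC t = (q t)%:C.
Proof.
have h4 : - 4^-1 = (- 4^-1)%:C :> C by rewrite rmorphN fmorphV rmorph_nat.
have h2 : 2^-1 = (2^-1)%:C :> C by rewrite fmorphV rmorph_nat.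
rewrite /qC mul1r mulN1r -rmorphN !expi_real mulrN cosN sinN /q h4 h2.
by apply: complex_eq; rewrite !raddfD /= ?mul0r; field.
Qed.

Let qC_continuous : ccontinuous qC.
Proof.
apply: ccontinuousD; first exact: ccontinuous_cst.
by apply: ccontinuousD; apply: ccontinuousM;
  [exact: ccontinuous_cst|exact: expi_ccontinuous
  |exact: ccontinuous_cst|exact: expi_ccontinuous].
Qed.

(** The powers of [q t = sin (pi t) ^ 2] are trigonometric polynomials which
    concentrate at [t = 1/2].  All the integrals of [q ^ N * phi] vanish, but if
    [phi (1/2)] were nonzero, the contribution of a neighbourhood of 1/2 would
    outweigh the rest for large [N]. *)
Lemma completeness (phi : R -> C) : ccontinuous phi ->
  (forall m : int, cint (fun t => expi (m%:~R * t%:C) * phi t) 0 1 = 0) ->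
  phi 2^-1 = 0.
Proof.
move=> cphi c0; have i01 : 0 <= (0 : R) <= 1 by rewrite lexx ler01.
have cpow N : ccontinuous (fun t => qC t ^+ N * phi t).
  elim: N => [|N IH]; first by under eq_fun do rewrite expr0 mul1r.
  under eq_fun do rewrite exprS -mulrA.
  exact: ccontinuousM.
have cA (m : int) N : ccontinuous (fun t => expi (m%:~R * t%:C) * (qC t ^+ N * phi t)).
  by apply: ccontinuousM => //; exact: expi_ccontinuous.
have kernel0 N (m : int) : cint (fun t => expi (m%:~R * t%:C) * (qC t ^+ N * phi t)) 0 1 = 0.
  elim: N m => [|N IH] m.
    by under eq_fun do rewrite expr0 mul1r; exact: c0.
  rewrite (_ : (fun t => _) =
    (fun t => 2^-1 * (expi (m%:~R * t%:C) * (qC t ^+ N * phi t)) +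
     (- 4^-1 * (expi ((m + 1)%:~R * t%:C) * (qC t ^+ N * phi t)) +
      - 4^-1 * (expi ((m - 1)%:~R * t%:C) * (qC t ^+ N * phi t))))); last first.
    apply/funext => t; rewrite exprS {1}/qC !mulrDl !mulN1r mul1r !rmorphD /=.
    rewrite !mulrDl !expiD rmorphN /= mulN1r mul1r.
    move: (qC t ^+ N) => Q; ring.
  have cZ k m' : ccontinuous (fun t => k * (expi (m'%:~R * t%:C) * (qC t ^+ N * phi t))).
    exact: ccontinuousM (ccontinuous_cst k) (cA m' N).
  rewrite (cint_linear _ (cA m N) (ccontinuousD (cZ _ _) (cZ _ _)) i01).
  rewrite (cint_linear _ (cA (m + 1) N) (cZ _ _) i01) (cintZ _ (cA (m - 1) N) i01).
  by rewrite !IH !mulr0 !addr0.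
apply/eqP/negPn/negP => phi0.
pose H t := Re ((phi 2^-1)^-1 * phi t).
have [cH _] : ccontinuous (fun t => (phi 2^-1)^-1 * phi t).
  by apply: ccontinuousM => //; exact: ccontinuous_cst.
have H1 : H 2^-1 = 1 by rewrite /H mulVf.
have cq : continuous q.
  by have [+ _] := qC_continuous; under eq_fun do rewrite qCE.
have cqN N : continuous (fun t => q t ^+ N).
  elim: N => [|N IH]; first by under eq_fun do rewrite expr0; exact: cst_continuous.
  under eq_fun do rewrite exprS; move=> t; apply: cvgM; [exact: cq|exact: IH].
have cHq N : continuous (fun t => H t * q t ^+ N).
  by move=> t; apply: cvgM; [exact: cH|exact: cqN].
have I0 N : rint (fun t => H t * q t ^+ N) 0 1 = 0.
  have := kernel0 N 0; under eq_fun do rewrite mulr0z mul0r expi0 mul1r.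
  move=> E; have := cintZ (phi 2^-1)^-1 (cpow N) i01.
  rewrite E mulr0 => /(congr1 (@complex.Re R)) /=.
  rewrite (_ : (fun x => Re _) = (fun t => H t * q t ^+ N)) //.
  apply/funext => t; rewrite qCE -rmorphXn /H mulrCA ReZ; exact: mulrC.
(* [H] is at least 1/2 near the peak of [q] and bounded below elsewhere. *)
have [d d0 Hd] : exists2 d : R, 0 < d < 2^-1 & forall t, `|2^-1 - t| <= d -> 2^-1 <= H t.
  have h2 : 0 < 2^-1 :> R by rewrite invr_gt0.
  have /cvgrPdist_le cH2 := cH 2^-1. have [r /= r0 Hr] := cH2 _ h2.
  have m0 : 0 < Num.min (r / 2) 4^-1 by rewrite lt_min; lra.
  have m1 : Num.min (r / 2) 4^-1 <= 4^-1 by rewrite ge_min lexx orbT.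
  exists (Num.min (r / 2) 4^-1); first by lra.
  move=> t ht; have {}ht : `|2^-1 - t| < r.
    by apply: (le_lt_trans ht); rewrite gt_min; apply/orP; left; lra.
  have := Hr t ht; rewrite -/(H _) -/(H t) H1 ler_norml; lra.
have [M M0 HM] : exists2 M : R, 0 <= M & forall t, 0 <= t <= 1 -> - M <= H t.
  have [|c _ Hc] := @EVT_max R (fun t => - H t) 0 1 ler01.
    by apply: continuous_subspaceT => t; apply: cvgN; exact: cH.
  exists (Num.max 0 (- H c)); first by rewrite le_max lexx.
  move=> t t01; rewrite lerNl; apply: le_trans (Hc t _) _; first by rewrite in_itv.
  by rewrite le_max lexx orbT.
have q_gt0 : 0 < q (2^-1 - d).
  apply: le_lt_trans (q_ge0 0) (q_lt _ _ _) => //; lra.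
have q12 : q (2^-1 - d) < q (2^-1 - d / 2) by apply: q_lt; lra.
set q1 := q (2^-1 - d) in q_gt0 q12; set q2 := q (2^-1 - d / 2) in q12.
have far_l t : 0 <= t <= 2^-1 - d -> q t <= q1 by move=> ht; apply: q_le; lra.
have far_r t : 2^-1 + d <= t <= 1 -> q t <= q1.
  by move=> ht; rewrite -q_sym; apply: far_l; lra.
have near t : 2^-1 - d / 2 <= t <= 2^-1 + d / 2 -> q2 <= q t.
  move=> ht; have [t2|t2] := leP t 2^-1; first by apply: q_le; lra.
  rewrite -q_sym; apply: q_le; lra.
have farH N t : 0 <= t <= 1 -> q t <= q1 -> - (M * q1 ^+ N) <= H t * q t ^+ N.
  move=> t01 qt; have qN : q t ^+ N <= q1 ^+ N by apply: lerXn2r; rewrite ?nnegrE ?q_ge0.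
  apply: (@le_trans _ _ (- M * q t ^+ N)).
    by rewrite mulNr lerN2 ler_wpM2l.
  by rewrite ler_wpM2r ?exprn_ge0 ?q_ge0 ?HM.
have key N : d / 2 * q2 ^+ N <= M * q1 ^+ N.
  set F := fun t => H t * q t ^+ N; have cF : continuous F := cHq N.
  have cc k : continuous (fun _ : R => k : R) by exact: cst_continuous.
  have A1 : - (M * q1 ^+ N) * (2^-1 - d - 0) <= rint F 0 (2^-1 - d).
    rewrite -rint_cst; last by lra.
    apply: rint_le => //; first by lra.
    by move=> t ht; apply: farH; [lra|exact: far_l].
  have A2 : 0 * (2^-1 - d / 2 - (2^-1 - d)) <= rint F (2^-1 - d) (2^-1 - d / 2).
    rewrite -rint_cst; last by lra.
    apply: rint_le => //; first by lra.
    move=> t ht; rewrite mulr_ge0 ?exprn_ge0 ?q_ge0 //.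
    by apply: le_trans (Hd t _); [lra|rewrite ler_norml; lra].
  have A3 : 2^-1 * q2 ^+ N * (2^-1 + d / 2 - (2^-1 - d / 2)) <=
      rint F (2^-1 - d / 2) (2^-1 + d / 2).
    rewrite -rint_cst; last by lra.
    apply: rint_le => //; first by lra.
    move=> t ht; apply: ler_pM; first by lra.
    - by rewrite exprn_ge0 ?q_ge0.
    - by apply: Hd; rewrite ler_norml; lra.
    - by apply: lerXn2r; rewrite ?nnegrE ?q_ge0 ?near.
  have A4 : 0 * (2^-1 + d - (2^-1 + d / 2)) <= rint F (2^-1 + d / 2) (2^-1 + d).
    rewrite -rint_cst; last by lra.
    apply: rint_le => //; first by lra.
    move=> t ht; rewrite mulr_ge0 ?exprn_ge0 ?q_ge0 //.
    by apply: le_trans (Hd t _); [lra|rewrite ler_norml; lra].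
  have A5 : - (M * q1 ^+ N) * (1 - (2^-1 + d)) <= rint F (2^-1 + d) 1.
    rewrite -rint_cst; last by lra.
    apply: rint_le => //; first by lra.
    by move=> t ht; apply: farH; [lra|exact: far_r].
  have := I0 N; rewrite -/F; move: A1 A2 A3 A4 A5; rewrite /rint.
  have X0 : 0 <= M * q1 ^+ N by rewrite mulr_ge0 // exprn_ge0 // ltW.
  have X1 : M * q1 ^+ N * d >= 0 by rewrite mulr_ge0 //; lra.
  move: (primitive F 0) (primitive F (2^-1 - d)) (primitive F (2^-1 - d / 2)).
  move: (primitive F (2^-1 + d / 2)) (primitive F (2^-1 + d)) (primitive F 1).
  move: X0 X1; move: (M * q1 ^+ N) (q2 ^+ N) => X Y X0 X1 *; lra.
pose c := q2 / q1 - 1.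
have c0' : 0 < c by rewrite /c subr_gt0 ltr_pdivlMr // mul1r.
have bernoulli N : 1 + N%:R * c <= (1 + c) ^+ N.
  elim: N => [|N IH]; first by rewrite expr0 mul0r addr0.
  rewrite exprS -natr1; have := ler_wpM2l (_ : 0 <= 1 + c) IH.
  have : 0 <= N%:R * c * c by rewrite !mulr_ge0 // ltW.
  by move=> h /(_ ltac:(lra)) H'; apply: le_trans H'; lra.
have key2 N : d / 2 * (1 + N%:R * c) <= M.
  apply: (@le_trans _ _ (d / 2 * (1 + c) ^+ N)); first by rewrite ler_wpM2l //; lra.
  have -> : 1 + c = q2 / q1 by rewrite /c; ring.
  by rewrite expr_div_n mulrA ler_pdivrMr ?exprn_gt0.
have dc : 0 < d / 2 * c by rewrite mulr_gt0 //; lra.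
have := key2 (Num.truncn (M / (d / 2 * c))).+1.
have /andP[_] := truncn_itv (divr_ge0 M0 (ltW dc)).
rewrite ltr_pdivrMr //; lra.
Qed.

End Completeness.
Arguments entire_expi {R}.

(** * Quasi-periodic functions are determined by n Fourier coefficients *)

Section QuasiPeriodic.
Variables (R : realType) (tau : R[i]).
Local Notation C := R[i].

Definition quasi_periodic (n : nat) (K : C) (f : C -> C) : Prop :=
  [/\ entire f, forall z, f (z + 1) = f z &
      forall z, f (z + tau) = K * expi (- (n%:R * z)) * f z].

Lemma quasi_periodic0 n K : quasi_periodic n K (fun=> 0).
Proof. by split=> [|//|z]; [exact: entire_cst|rewrite mulr0]. Qed.

Lemma quasi_periodic_linear n K k f g :
  quasi_periodic n K f -> quasi_periodic n K g ->
  quasi_periodic n K (fun z => k * f z + g z).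
Proof.
move=> [ef f1 ft] [eg g1 gt]; split=> [|z|z]; last 1 first.
- by rewrite ft gt; ring.
- exact: entireD (entireM (entire_cst k) ef) eg.
- by rewrite f1 g1.
Qed.

Lemma quasi_periodic_sum n K (I : Type) (r : seq I) (a : I -> C) (F : I -> C -> C) :
  (forall i, quasi_periodic n K (F i)) ->
  quasi_periodic n K (fun z => \sum_(i <- r) a i * F i z).
Proof.
move=> qF; elim: r => [|i r IH].
  by under eq_fun do rewrite big_nil; exact: quasi_periodic0.
by under eq_fun do rewrite big_cons; exact: quasi_periodic_linear.
Qed.

Definition fourier (f : C -> C) (m : int) : C :=
  cint (fun t => expi (- m%:~R * t%:C) * f t%:C) 0 1.

Let i01 : 0 <= (0 : R) <= 1.
Proof. by rewrite lexx ler01. Qed.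

Lemma fourier_ccontinuous f (k : C) : entire f ->
  ccontinuous (fun t : R => expi (k * t%:C) * f t%:C).
Proof.
move=> ef; apply: ccontinuousM; first exact: expi_ccontinuous.
have -> : (fun t : R => f t%:C) = (fun t : R => f (0 + t%:C * 1)).
  by apply/funext => t; rewrite add0r mulr1.
exact: entire_ccontinuous.
Qed.

Lemma fourier_linear k f g m : entire f -> entire g ->
  fourier (fun z => k * f z + g z) m = k * fourier f m + fourier g m.
Proof.
move=> ef eg; rewrite /fourier -cint_linear //; try exact: fourier_ccontinuous.
by congr cint; apply/funext => t; ring.
Qed.

Lemma fourier_sum m (I : Type) (r : seq I) (a : I -> C) (F : I -> C -> C) :
  (forall i, entire (F i)) ->
  fourier (fun z => \sum_(i <- r) a i * F i z) m = \sum_(i <- r) a i * fourier (F i) m.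
Proof.
move=> eF; elim: r => [|i r IH].
  rewrite big_nil /fourier; under eq_fun do rewrite big_nil mulr0.
  exact: cint0.
have -> : (fun z => \sum_(j <- i :: r) a j * F j z) =
    (fun z => a i * F i z + \sum_(j <- r) a j * F j z).
  by apply/funext => z; rewrite big_cons.
rewrite big_cons -IH fourier_linear //.
by apply: entire_sum => j _; exact: entireM (entire_cst _) (eF j).
Qed.

(** Fourier coefficients may be computed along any horizontal line. *)
Lemma fourier_line f m (p : C) : entire f -> (forall z, f (z + 1) = f z) ->
  cint (fun t => expi (- m%:~R * (p + t%:C)) * f (p + t%:C)) 0 1 = fourier f m.
Proof.
move=> ef f1; pose g z := expi (- m%:~R * z) * f z.
have -> : fourier f m = cint (fun t => g (0 + t%:C)) 0 1.
  rewrite /fourier; have -> // : (fun t : R => expi (- m%:~R * t%:C) * f t%:C) =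
      (fun t : R => g (0 + t%:C)).
  by apply/funext => t; rewrite add0r.
apply: (@period_integral_const _ g); first exact: entireM (entire_expi _) ef.
by move=> z; rewrite /g f1 mulrDr mulr1 expiD -rmorphN expi_int mulr1.
Qed.

(** Compute the coefficient along the line through [tau]. *)
Lemma fourier_shift n K f m : quasi_periodic n K f ->
  fourier f m = K * expi (- m%:~R * tau) * fourier f (m + n%:Z).
Proof.
move=> [ef f1 ft]; rewrite -(fourier_line m tau ef f1) /fourier -cintZ //; last first.
  exact: fourier_ccontinuous.
congr cint; apply/funext => t; rewrite [tau + _]addrC ft rmorphD /= opprD.
rewrite !mulrDr !mulrDl !expiD -mulNr; ring.
Qed.

Lemma fourier_eq0 n K f : K != 0 -> (0 < n)%N -> quasi_periodic n K f ->
  (forall i : 'I_n, fourier f i%:Z = 0) -> forall z, f z = 0.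
Proof.
move=> K0 n0 qf f0; have [ef f1 _] := qf.
have stepE m : (fourier f m == 0) = (fourier f (m + n%:Z) == 0).
  by rewrite (fourier_shift m qf) mulf_eq0 mulf_eq0 (negbTE K0) (negbTE (expi_neq0 _)).
have all0 m : fourier f m = 0.
  have [r [k ->]] : exists (r : 'I_n) (k : int), m = r%:Z + k * n%:Z.
    have n0' : n%:Z != 0 by rewrite eqz_nat -lt0n.
    have r_ge0 : 0 <= (m %% n)%Z by rewrite modz_ge0.
    have r_lt : (`|(m %% n)%Z|%N < n)%N.
      by rewrite -ltz_nat gez0_abs // ltz_pmod.
    exists (Ordinal r_lt), (m %/ n)%Z.
    by rewrite /= gez0_abs // addrC -divz_eq.
  apply/eqP; elim: k => [|k IH|k IH].
  - by rewrite mul0r addr0 f0.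
  - by rewrite -addn1 PoszD mulrDl mul1r addrA -stepE.
  by rewrite stepE -addn1 PoszD opprD mulrDl mulN1r addrA subrK.
move=> z; pose p := z - (2^-1)%:C.
rewrite (_ : z = p + (2^-1)%:C); last by rewrite subrK.
apply: (@completeness _ (fun t => f (p + t%:C))).
  have -> : (fun t : R => f (p + t%:C)) = (fun t : R => f (p + t%:C * 1)).
    by apply/funext => t; rewrite mulr1.
  exact: entire_ccontinuous.
move=> m; have := fourier_line (- m) p ef f1; rewrite all0 => E.
apply/eqP; have := E; rewrite rmorphN opprK.
rewrite (_ : (fun t => _) =
  (fun t => expi (m%:~R * p) * (expi (m%:~R * t%:C) * f (p + t%:C)))); last first.
  by apply/funext => t; rewrite mulrDr expiD mulrA.
rewrite cintZ //; first by move/eqP; rewrite mulf_eq0 (negbTE (expi_neq0 _)).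
apply: ccontinuousM; first exact: expi_ccontinuous.
have -> : (fun t : R => f (p + t%:C)) = (fun t : R => f (p + t%:C * 1)).
  by apply/funext => t; rewrite mulr1.
exact: entire_ccontinuous.
Qed.

(** The matrix of the first [n] Fourier coefficients of the [L i] is invertible,
    for a vector in its kernel gives a vanishing combination of the [L i].  Hence
    some combination of the [L i] has the same coefficients as [f]. *)
Lemma interpolation n K (L : 'I_n -> C -> C) (x : 'I_n -> C) (f : C -> C) :
  K != 0 -> (0 < n)%N -> (forall i, quasi_periodic n K (L i)) ->
  (forall i j, L i (x j) = (i == j)%:R) -> quasi_periodic n K f ->
  forall z, f z = \sum_i f (x i) * L i z.
Proof.
move=> K0 n0 qL Lx qf; have eL i : entire (L i) by case: (qL i).
have comb_x a j : \sum_i a i * L i (x j) = a j.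
  rewrite (bigD1 j) //= Lx eqxx mulr1 big1 ?addr0 // => i ij.
  by rewrite Lx (negbTE ij) mulr0.
pose M := \matrix_(i < n, j < n) fourier (L i) j%:Z.
have M_unit : M \in unitmx.
  rewrite unitmxE unitfE; apply/negP => /det0P[v v0 vM].
  move/negP: v0; apply; apply/eqP/rowP => j; rewrite mxE.
  rewrite -[LHS](comb_x (fun i => v 0 i)).
  apply: (fourier_eq0 K0 n0 (quasi_periodic_sum _ _ qL)) => i.
  rewrite fourier_sum //; move/rowP/(_ i): vM; rewrite !mxE => vMi; rewrite -[RHS]vMi.
  by apply: eq_bigr => k _; rewrite mxE.
pose a := (\row_j fourier f j%:Z) *m invmx M.
have fE z : f z = \sum_i a 0 i * L i z.
  have qg := quasi_periodic_linear (-1) (quasi_periodic_sum (index_enum 'I_n) (a 0) qL) qf.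
  have : forall z, -1 * (\sum_i a 0 i * L i z) + f z = 0.
    apply: (fourier_eq0 K0 n0 qg) => i.
    rewrite fourier_linear; [|by case: (quasi_periodic_sum (index_enum 'I_n) (a 0) qL)|by case: qf].
    rewrite fourier_sum //; have /rowP/(_ i) : a *m M = \row_j fourier f j%:Z.
      by rewrite /a mulmxKV.
    rewrite !mxE => <-; rewrite mulN1r addrC; apply/eqP; rewrite subr_eq0; apply/eqP.
    by apply: eq_bigr => k _; rewrite !mxE.
  by move=> /(_ z) /eqP; rewrite mulN1r addrC subr_eq0 => /eqP.
by move=> z; rewrite fE; apply: eq_bigr => i _; rewrite fE comb_x.
Qed.

End QuasiPeriodic.

(** * Entire power series *)

Section GeometricSeries.
Variable R : realType.
Local Notation C := R[i].
Local Notation Re := complex.Re.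
Local Notation Im := complex.Im.

Lemma ler_exprn (x y : R) k : 0 <= x -> x <= y -> x ^+ k <= y ^+ k.
Proof.
by move=> x0 xy; apply: lerXn2r => //; rewrite nnegrE // (le_trans x0).
Qed.

Lemma expr_small (x e : R) : 0 <= x < 1 -> 0 < e ->
  exists N, forall k, (N <= k)%N -> x ^+ k <= e.
Proof.
move=> /andP[x0 x1] e0; have : `|x| < 1 by rewrite ger0_norm.
move=> /cvg_expr/cvgrPdist_le/(_ _ e0)[N _ HN]; exists N => k /HN.
by rewrite sub0r normrN ger0_norm // exprn_ge0.
Qed.

(** Inequalities between limits are obtained from those between partial sums. *)
Lemma le_of_geometric (x y K : R) : (forall N, x <= y + K * 2^-1 ^+ N) -> x <= y.
Proof.
move=> le_xy; apply/ler_addgt0Pr => e e0.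
have K1 : 0 < `|K| + 1 by have := normr_ge0 K; lra.
have [||N HN] := @expr_small 2^-1 (e / (`|K| + 1)); first by lra.
  by rewrite divr_gt0.
apply: (le_trans (le_xy N)); rewrite lerD2l.
apply: (@le_trans _ _ ((`|K| + 1) * (e / (`|K| + 1)))).
  have p0 : 0 <= 2^-1 ^+ N :> R by rewrite exprn_ge0.
  apply: (@le_trans _ _ ((`|K| + 1) * 2^-1 ^+ N)).
    by rewrite ler_wpM2r //; have := ler_norm K; lra.
  by rewrite ler_wpM2l ?HN // ltW.
by rewrite mulrCA divff ?mulr1 // gt_eqF.
Qed.

(** All the series below converge so fast that they can be compared with a
    geometric series of ratio 1/2; errors are measured in powers of 1/2. *)
Definition geometric_bound (u : nat -> C) (M : R) : Prop :=
  forall j, modulus (u j) <= M * 2^-1 ^+ j.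

Definition csum (u : nat -> C) : C := limn (series (u : nat -> C^o)).

Lemma geometric_tail (u : nat -> C) M N k : geometric_bound u M ->
  modulus (\sum_(N <= j < N + k) u j) <= 2 * M * 2^-1 ^+ N.
Proof.
move=> uM; have M0 : 0 <= M.
  by have := uM 0%N; rewrite expr0 mulr1; apply: le_trans; exact: modulus_ge0.
suff : modulus (\sum_(N <= j < N + k) u j) <= 2 * M * (2^-1 ^+ N - 2^-1 ^+ (N + k)).
  move=> /le_trans; apply; rewrite ler_wpM2l ?mulr_ge0 //.
  by rewrite lerBlDr lerDl exprn_ge0.
elim: k => [|k IH].
  by rewrite addn0 big_geq // modulus0 subrr mulr0.
rewrite addnS big_nat_recr ?leq_addr //=.
apply: (le_trans (modulusD _ _)); have := uM (N + k)%N.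
rewrite exprS; move: IH; move: (modulus _) (modulus _) (2^-1 ^+ N) (2^-1 ^+ (N + k)).
move=> a b c d; lra.
Qed.

Lemma csum_cvg (u : nat -> C) M : geometric_bound u M ->
  exists l, (series (u : nat -> C^o) @ \oo --> (l : C^o)).
Proof.
move=> uM; have half : `|2^-1 : R| < 1 by rewrite ger0_norm //; lra.
have key (v : nat -> R) : (forall j, `|v j| <= M * 2^-1 ^+ j) -> cvgn (series v).
  move=> vM; apply: normed_cvg.
  apply: (@series_le_cvg _ _ (geometric M 2^-1)) => [n|n|n|] /=.
  - exact: normr_ge0.
  - exact: le_trans (normr_ge0 _) (vM n).
  - exact: vM.
  - exact: is_cvg_geometric_series.
have /cvg_ex[a ca] := key _ (fun j => le_trans (ge_Re _) (uM j)).
have /cvg_ex[b cb] := key _ (fun j => le_trans (ge_Im _) (uM j)).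
exists (a +i* b); apply/cvgrPdist_le => e /gt0_real[-> e0].
have e2 : 0 < complex.Re e / 2 by lra.
have /cvgrPdist_le/(_ _ e2) Ha := ca; have /cvgrPdist_le/(_ _ e2) Hb := cb.
near=> n; rewrite normE lecR; apply: (le_trans (modulus_le _)).
have HA : `|a - series (fun j => Re (u j)) n| <= complex.Re e / 2 by near: n.
have HB : `|b - series (fun j => Im (u j)) n| <= complex.Re e / 2 by near: n.
rewrite [X in `|X| + _ <= _](_ : _ = a - series (fun j => Re (u j)) n); last first.
  by rewrite raddfB /=; congr (_ - _); exact: raddf_sum.
rewrite [X in _ + `|X| <= _](_ : _ = b - series (fun j => Im (u j)) n); last first.
  by rewrite raddfB /=; congr (_ - _); exact: raddf_sum.
lra.
Unshelve. all: by end_near. Qed.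

Lemma csum_approx (u : nat -> C) M N : geometric_bound u M ->
  modulus (csum u - \sum_(0 <= j < N) u j) <= 2 * M * 2^-1 ^+ N.
Proof.
move=> uM; have [l cl] := csum_cvg uM.
have -> : csum u = l by exact: cvg_lim cl.
apply/ler_addgt0Pr => e e0; have eC : (0 : C) < e%:C by rewrite ltcR.
move/cvgrPdist_le: cl => /(_ _ eC)[n0 _ H].
have := H (N + n0)%N (leq_addl _ _); rewrite normE lecR /series /= => Hn.
rewrite (_ : _ - _ = (l - \sum_(0 <= k < N + n0) u k) + \sum_(N <= j < N + n0) u j).
  apply: (le_trans (modulusD _ _)); rewrite [leRHS]addrC; apply: lerD => //.
  exact: geometric_tail.
by rewrite (@big_cat_nat _ _ _ N 0 (N + n0)) ?leq_addr //=; ring.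
Qed.

Lemma csum_unique (u : nat -> C) M l K : geometric_bound u M ->
  (forall N, modulus (l - \sum_(0 <= j < N) u j) <= K * 2^-1 ^+ N) -> csum u = l.
Proof.
move=> uM lK; apply/eqP; rewrite -subr_eq0 -modulus_eq0 eq_le modulus_ge0 andbT.
apply: (@le_of_geometric _ _ (2 * M + K)) => N; rewrite add0r.
rewrite (_ : csum u - l = (csum u - \sum_(0 <= j < N) u j) - (l - \sum_(0 <= j < N) u j)).
  apply: (le_trans (modulusD _ _)); rewrite modulusN mulrDl.
  by apply: lerD; [exact: csum_approx|exact: lK].
by ring.
Qed.

Lemma csumZ (u : nat -> C) M k : geometric_bound u M ->
  csum (fun j => k * u j) = k * csum u.
Proof.
move=> uM; apply: (@csum_unique _ (modulus k * M) _ (modulus k * (2 * M))).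
  by move=> j; rewrite modulusM -mulrA ler_wpM2l ?modulus_ge0.
move=> N; rewrite -mulr_sumr -mulrBr modulusM -mulrA ler_wpM2l ?modulus_ge0 //.
exact: csum_approx.
Qed.

Lemma csum_recl (u : nat -> C) M : geometric_bound u M ->
  csum u = u 0%N + csum (fun j => u j.+1).
Proof.
move=> uM; have M0 : 0 <= M.
  by have := uM 0%N; rewrite expr0 mulr1; apply: le_trans; exact: modulus_ge0.
have uM' : geometric_bound (fun j => u j.+1) M.
  move=> j; apply: (le_trans (uM j.+1)); rewrite ler_wpM2l // exprS.
  by rewrite ler_piMl ?exprn_ge0 //; lra.
apply: (csum_unique (K := 4 * M) uM) => -[|N].
  rewrite big_geq // subr0 expr0 mulr1.
  have := csum_approx 0 uM'; rewrite big_geq // subr0 expr0 mulr1 => H.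
  apply: (le_trans (modulusD _ _)); have := uM 0%N; rewrite expr0 mulr1; lra.
rewrite big_nat_recl //= opprD addrACA subrr add0r.
apply: (le_trans (csum_approx N uM')); rewrite exprS.
by rewrite le_eqVlt; apply/orP; left; apply/eqP; field.
Qed.

End GeometricSeries.

Section EntirePowerSeries.
Variable R : realType.
Local Notation C := R[i].

(** The coefficients of a power series of infinite radius of convergence. *)
Definition entire_coef (b : nat -> C) : Prop :=
  forall r : R, 0 < r -> exists M, forall j, modulus (b j) * r ^+ j <= M.

Lemma entire_coef_bound (b : nat -> C) (r : R) : entire_coef b -> 0 < r ->
  exists M, forall x, modulus x <= r -> geometric_bound (fun j => b j * x ^+ j) M.
Proof.
move=> bE r0; have [|M bM] := bE (2 * r); first by rewrite mulr_gt0.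
exists M => x xr j; rewrite modulusM modulusX exprVn ler_pdivlMr ?exprn_gt0 //.
apply: le_trans (bM j); rewrite -mulrA ler_wpM2l ?modulus_ge0 //.
rewrite exprMn mulrC ler_wpM2l ?exprn_ge0 //.
by apply: ler_exprn => //; exact: modulus_ge0.
Qed.

Definition power_series (b : nat -> C) (x : C) : C := csum (fun j => b j * x ^+ j).

(** The remainder of the first-order expansion of a monomial, in a form which can
    be summed against the coefficients of an entire power series. *)
Lemma expr_taylor1 (w h : C) (r : R) (j : nat) :
  modulus w <= r -> modulus (w + h) <= r -> 1 <= r ->
  modulus ((w + h) ^+ j - w ^+ j - h * (j%:R * w ^+ j.-1)) <=
    j%:R ^+ 2 * (modulus h ^+ 2 * r ^+ j).
Proof.
move=> wr whr r1; elim: j => [|j IH].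
  by rewrite !expr0 subrr mul0r mulr0 subr0 modulus0 expr0n /= mul0r.
have E : (w + h) ^+ j.+1 - w ^+ j.+1 - h * (j.+1%:R * w ^+ j) =
  (w + h) * ((w + h) ^+ j - w ^+ j - h * (j%:R * w ^+ j.-1)) + j%:R * h ^+ 2 * w ^+ j.-1.
  case: j {IH} => [|j]; first by rewrite !expr0 !expr1 mul0r; ring.
  by rewrite !exprS -[j.+2%:R]natr1 /=; ring.
rewrite /= E; apply: (le_trans (modulusD _ _)).
have r0 : 0 <= r by lra.
have B1 : modulus ((w + h) * ((w + h) ^+ j - w ^+ j - h * (j%:R * w ^+ j.-1))) <=
    r * (j%:R ^+ 2 * (modulus h ^+ 2 * r ^+ j)).
  by rewrite modulusM; apply: ler_pM => //; exact: modulus_ge0.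
have B2 : modulus (j%:R * h ^+ 2 * w ^+ j.-1) <= j%:R * (modulus h ^+ 2 * r ^+ j.+1).
  rewrite -(rmorph_nat (real_complex R)) !modulusM modulus_real !modulusX normr_nat -mulrA.
  apply: ler_wpM2l; first exact: ler0n.
  apply: ler_wpM2l; first by rewrite mulr_ge0 ?modulus_ge0.
  apply: (@le_trans _ _ (r ^+ j.-1)).
    by apply: ler_exprn => //; exact: modulus_ge0.
  by rewrite ler_weXn2l //; lia.
apply: (le_trans (lerD B1 B2)); rewrite -natr1 [r ^+ j.+1]exprS.
have X0 : 0 <= modulus h ^+ 2 * (r * r ^+ j) by rewrite !mulr_ge0 ?exprn_ge0 ?modulus_ge0.
have X1 : 0 <= j%:R * (modulus h ^+ 2 * (r * r ^+ j)) by rewrite mulr_ge0.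
move: X0 X1; move: (modulus h ^+ 2) (r ^+ j) (j%:R : R) => a c d X0 X1.
rewrite -subr_ge0 (_ : _ - _ = a * (r * c) + d * (a * (r * c))); last by ring.
exact: addr_ge0.
Qed.

Lemma natr_le_pow2 j : j%:R <= 2 ^+ j :> R.
Proof. by rewrite -natrX ler_nat ltnW // ltn_expl. Qed.

(** The first-order expansions of the partial sums have a remainder
    [O (h ^ 2)] uniformly in the number of terms. *)
Lemma entire_power_series (b : nat -> C) : entire_coef b -> entire (power_series b).
Proof.
move=> bE; apply/entireP => w.
pose r := modulus w + 1; have r1 : 1 <= r by rewrite /r lerDr modulus_ge0.
have r0 : 0 < r by lra.
have [M0 HM0] := entire_coef_bound bE r0.
(* Of the factor [8 ^ j] gained, [4 ^ j] dominates [j ^ 2] and [2 ^ j] is left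
   for convergence. *)
have [|M bM] := bE (8 * r); first by rewrite mulr_gt0.
have bM' j : modulus (b j) * (4 ^+ j * r ^+ j) <= M * 2^-1 ^+ j.
  rewrite exprVn ler_pdivlMr ?exprn_gt0 //.
  apply: le_trans (bM j); rewrite -mulrA ler_wpM2l ?modulus_ge0 //.
  by rewrite mulrAC -!exprMn (_ : 4 * 2 * r = 8 * r) //; ring.
pose G j : C := b j * (j%:R * w ^+ j.-1).
have GM : geometric_bound G M.
  move=> j; apply: le_trans (bM' j); rewrite modulusM ler_wpM2l ?modulus_ge0 //.
  rewrite modulusM -(rmorph_nat (real_complex R)) modulus_real normr_nat modulusX.
  apply: ler_pM; rewrite ?exprn_ge0 ?modulus_ge0 //.
    apply: (le_trans (natr_le_pow2 j)); apply: ler_exprn; lra.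
  apply: (@le_trans _ _ (r ^+ j.-1)).
    by apply: ler_exprn; [exact: modulus_ge0|rewrite /r lerDl].
  by rewrite ler_weXn2l //; lia.
have M_ge0 : 0 <= M.
  by have := bM 0%N; rewrite expr0 mulr1; apply: le_trans; exact: modulus_ge0.
exists (csum G) => e e0.
exists (Num.min 1 (e / (2 * M + 1))); first by rewrite lt_min ltr01 divr_gt0 //; lra.
move=> h; rewrite lt_min => /andP[h1 he].
have wr : modulus w <= r by rewrite /r lerDl.
have whr : modulus (w + h) <= r.
  by apply: (le_trans (modulusD _ _)); rewrite /r lerD2l ltW.
apply: (@le_trans _ _ (modulus h ^+ 2 * (2 * M))); last first.
  rewrite exprS expr1 mulrC mulrA ler_wpM2r ?modulus_ge0 //.
  move: he; rewrite ltr_pdivlMr; last by lra.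
  by have := modulus_ge0 h; move: (modulus h) => t; lra.
pose S x N := \sum_(0 <= j < N) b j * x ^+ j.
apply: (@le_of_geometric _ _ _ (2 * M0 + 2 * M0 + 2 * M)) => N.
rewrite /power_series; set F1 := csum _; set F0 := csum _; set F2 := csum G.
have A1 : modulus (F1 - S (w + h) N) <= 2 * M0 * 2^-1 ^+ N.
  exact: csum_approx (HM0 _ whr).
have A0 : modulus (F0 - S w N) <= 2 * M0 * 2^-1 ^+ N.
  exact: csum_approx (HM0 _ wr).
have A2 : modulus (F2 - \sum_(0 <= j < N) G j) <= 2 * M * 2^-1 ^+ N.
  exact: csum_approx.
have A3 : modulus (S (w + h) N - S w N - (\sum_(0 <= j < N) G j) * h) <=
    modulus h ^+ 2 * (2 * M).
  rewrite /S mulr_suml -!sumrB; apply: (le_trans (modulus_sum _ _ _)).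
  apply: (@le_trans _ _ (\sum_(0 <= j < N) modulus h ^+ 2 * (M * 2^-1 ^+ j))).
    apply: ler_sum => j _.
    rewrite (_ : _ - _ = b j * ((w + h) ^+ j - w ^+ j - h * (j%:R * w ^+ j.-1)));
      last by rewrite /G; ring.
    rewrite modulusM.
    apply: (le_trans (ler_wpM2l (modulus_ge0 _) (expr_taylor1 j wr whr r1))).
    have -> : modulus (b j) * (j%:R ^+ 2 * (modulus h ^+ 2 * r ^+ j)) =
        modulus h ^+ 2 * (modulus (b j) * (j%:R ^+ 2 * r ^+ j)) by ring.
    apply: ler_wpM2l; first by rewrite exprn_ge0 ?modulus_ge0.
    apply: le_trans (bM' j); apply: ler_wpM2l; first exact: modulus_ge0.
    apply: ler_wpM2r; first by rewrite exprn_ge0 // ltW.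
    rewrite (_ : 4 = 2 ^+ 2) -?exprM; last by ring.
    by rewrite mulnC exprM; apply: ler_exprn; [exact: ler0n|exact: natr_le_pow2].
  rewrite -mulr_sumr ler_wpM2l ?exprn_ge0 ?modulus_ge0 // -mulr_sumr mulrC ler_wpM2r //.
  suff -> : \sum_(0 <= j < N) 2^-1 ^+ j = 2 - 2 * 2^-1 ^+ N :> R.
    by rewrite lerBlDr lerDl mulr_ge0 ?exprn_ge0.
  elim: N {A1 A0 A2} => [|N IH]; first by rewrite big_geq // expr0; ring.
  by rewrite big_nat_recr //= IH exprS; field.
rewrite (_ : F1 - F0 - F2 * h = (S (w + h) N - S w N - (\sum_(0 <= j < N) G j) * h)
   + ((F1 - S (w + h) N) - (F0 - S w N) - (F2 - \sum_(0 <= j < N) G j) * h)); last by ring.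
apply: (le_trans (modulusD _ _)); apply: lerD => //.
have A4 : modulus ((F2 - \sum_(0 <= j < N) G j) * h) <= 2 * M * 2^-1 ^+ N.
  rewrite modulusM -[leRHS]mulr1; apply: ler_pM; rewrite ?modulus_ge0 //; exact: ltW.
have tri (x y t : C) : modulus (x - y - t) <= modulus x + modulus y + modulus t.
  have := modulusD (x - y) (- t); have := modulusD x (- y); rewrite !modulusN; lra.
by apply: (le_trans (tri _ _ _)); rewrite [leRHS]mulrDl [X in _ <= X + _]mulrDl !lerD.
Qed.

End EntirePowerSeries.

(** * The theta function *)

(* Being a product, the exponential would otherwise be unfolded by rewriting
   with laws of multiplication. *)
Opaque cexp expi.

Section PartialTheta.
Variables (R : realType) (Q : R[i]).
Local Notation C := R[i].
Hypothesis Q1 : modulus Q < 1.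

(** With [Q = exp (2 pi i tau)] the terms [j >= 0] of the theta series are, up
    to a common factor, [Q ^ (j (j + 1) / 2) x ^ j]. *)
Definition partial_theta_coef (j : nat) : C := Q ^+ 'C(j.+1, 2).

Lemma partial_theta_coefS j :
  partial_theta_coef j.+1 = partial_theta_coef j * Q ^+ j.+1.
Proof. by rewrite /partial_theta_coef binS bin1 exprD. Qed.

(** The quotient of consecutive terms is [Q ^ j.+1 r], which is eventually at
    most 1 in modulus. *)
Lemma entire_partial_theta_coef : entire_coef partial_theta_coef.
Proof.
move=> r r0; have Qr : 0 <= modulus Q < 1 by rewrite modulus_ge0.
have [|J HJ] := @expr_small R (modulus Q) r^-1 Qr; first by rewrite invr_gt0.
pose t j := modulus (partial_theta_coef j) * r ^+ j.
have t0 j : 0 <= t j by rewrite mulr_ge0 ?modulus_ge0 ?exprn_ge0 ?ltW.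
exists (\sum_(0 <= i < J.+1) t i) => j; rewrite -/(t j).
have small i : (i <= J)%N -> t i <= \sum_(0 <= i < J.+1) t i.
  move=> iJ; rewrite big_mkord (bigD1 (Ordinal (iJ : (i < J.+1)%N))) //= lerDl.
  by apply: sumr_ge0.
have [/small//|/ltnW] := leqP j J.
elim: j => [|j IH]; first by rewrite leqn0 => /eqP J0; exact: small.
rewrite leq_eqVlt => /orP[/eqP<-|]; first exact: small.
rewrite ltnS => Jj; apply: le_trans (IH Jj).
rewrite /t partial_theta_coefS modulusM -mulrA; apply: ler_wpM2l; first exact: modulus_ge0.
rewrite [r ^+ _]exprS mulrA -[leRHS]mul1r; apply: ler_wpM2r; first by rewrite exprn_ge0 ?ltW.
by rewrite modulusX -ler_pdivlMr // mul1r HJ // ltnW.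
Qed.

Definition partial_theta (x : C) : C := power_series partial_theta_coef x.

Lemma partial_theta_bound x :
  exists M, geometric_bound (fun j => partial_theta_coef j * x ^+ j) M.
Proof.
have x0 : 0 < modulus x + 1 by have := modulus_ge0 x; lra.
have [M HM] := entire_coef_bound entire_partial_theta_coef x0.
by exists M; apply: HM; lra.
Qed.

Lemma entire_partial_theta : entire partial_theta.
Proof. exact: entire_power_series entire_partial_theta_coef. Qed.

(** Taking off the first term replaces [x] by [Q x]: from this comes the
    behaviour of theta under the shift by [tau]. *)
Lemma partial_theta_step x : partial_theta x = 1 + Q * x * partial_theta (Q * x).
Proof.
have [M HM] := partial_theta_bound x; have [M' HM'] := partial_theta_bound (Q * x).
rewrite /partial_theta /power_series (csum_recl HM) -(csumZ _ HM').
rewrite {1}/partial_theta_coef bin_small // !expr0 mulr1; congr (_ + csum _).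
apply/funext => j; rewrite partial_theta_coefS [x ^+ j.+1]exprS exprMn [Q ^+ j.+1]exprS.
by ring.
Qed.

End PartialTheta.
Arguments entire_partial_theta {R Q} _.

Section ThetaFunction.
Variables (R : realType) (tau : R[i]).
Local Notation C := R[i].
Hypothesis tau_gt0 : 0 < complex.Im tau.

Let Q : C := expi tau.

Lemma modulus_nome : modulus (expi tau) < 1.
Proof.
rewrite expiE modulus_cexp -[ltRHS]expR0 ltr_expR.
rewrite (_ : 2 * pi%:C * 'i%C * tau = (2 * pi)%:C * ('i%C * tau)); last first.
  by rewrite rmorphM /= rmorph_nat; ring.
rewrite ReZ ReM /= mul0r sub0r mul1r mulrN oppr_lt0 mulr_gt0 // mulr_gt0 //.
exact: pi_gt0.
Qed.

Let prefactor (z : C) : C := cexp ('i%C * pi%:C * tau / 4 + 'i%C * pi%:C * (z + 2^-1)).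

Let bin2E (j : nat) : ('C(j.+1, 2)%:R * 2 : C) = j%:R * (j%:R + 1).
Proof.
elim: j => [|j IH]; first by rewrite bin_small // !mul0r.
by rewrite binS bin1 natrD mulrDl IH -natr1; ring.
Qed.

Let theta_term_pos z (j : nat) : theta_term tau z (Posz j) =
  prefactor z * (partial_theta_coef Q j * expi (z + 2^-1) ^+ j).
Proof.
rewrite /theta_term /prefactor /partial_theta_coef /Q !expiE -!cexpMn -!cexpD.
congr cexp; have := bin2E j; rewrite -[(Posz j)%:~R]/(j%:R : C).
move: ('C(j.+1, 2)%:R : C) (j%:R : C) => b c E.
have -> : b = c * (c + 1) / 2 by rewrite -E mulfK // pnatr_eq0.
by field.
Qed.

Let theta_term_neg z (j : nat) : theta_term tau z (Negz j) =
  prefactor z * (expi (z + 2^-1))^-1 * (partial_theta_coef Q j * (expi (z + 2^-1))^-1 ^+ j).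
Proof.
rewrite /theta_term /prefactor /partial_theta_coef /Q -expiN !expiE -!cexpMn -!cexpD.
congr cexp; have := bin2E j.
have -> : (Negz j)%:~R = - (j%:R + 1) :> C by rewrite NegzE mulrNz natr1.
move: ('C(j.+1, 2)%:R : C) (j%:R : C) => b c E.
have -> : b = c * (c + 1) / 2 by rewrite -E mulfK // pnatr_eq0.
by field.
Qed.

(** The sum of [Q ^ (j (j + 1) / 2) x ^ j] over all integers [j], the negative
    ones being folded by [j -> -1 - j]. *)
Let bilateral (x : C) : C := partial_theta Q x + x^-1 * partial_theta Q x^-1.

Lemma theta_bilateral z : theta tau z = - (prefactor z * bilateral (expi (z + 2^-1))).
Proof.
have Q1 := modulus_nome.
have [M HM] := partial_theta_bound Q1 (expi (z + 2^-1)).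
have [M' HM'] := partial_theta_bound Q1 (expi (z + 2^-1))^-1.
rewrite /theta /bilateral mulrDr mulrA; congr (- (_ + _)).
  rewrite -[RHS](csumZ _ HM); apply: (congr1 (fun u : nat -> C^o => limn (series u))).
  by apply/funext => j; rewrite theta_term_pos.
rewrite -[RHS](csumZ _ HM'); apply: (congr1 (fun u : nat -> C^o => limn (series u))).
by apply/funext => j; rewrite theta_term_neg.
Qed.

Let bilateralV x : x != 0 -> bilateral x^-1 = x * bilateral x.
Proof.
move=> x0; rewrite /bilateral invrK.
by move: (partial_theta Q x) (partial_theta Q x^-1) => a b; field.
Qed.

Let bilateral_shift x : x != 0 -> bilateral (Q * x) = (Q * x)^-1 * bilateral x.
Proof.
move=> x0; have Q0 : Q != 0 := expi_neq0 tau; have Q1 : modulus Q < 1 := modulus_nome.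
rewrite /bilateral (partial_theta_step Q1 x) (partial_theta_step Q1 (Q * x)^-1).
have -> : Q * (Q * x)^-1 = x^-1 by field; rewrite x0.
move: (partial_theta Q (Q * x)) (partial_theta Q x^-1) Q0 => a b.
by move: (Q) => q q0; field; rewrite x0 q0.
Qed.

Let half_turn (z : C) : expi (z + 2^-1) = - expi z.
Proof.
rewrite expiD [expi 2^-1](_ : _ = -1) ?mulrN1 // expiE -cexp_pi.
by congr cexp; field.
Qed.

Lemma theta_odd z : theta tau (- z) = - theta tau z.
Proof.
have e0 := expi_neq0 z; rewrite !theta_bilateral !half_turn expiN -invrN.
rewrite bilateralV ?oppr_eq0 // mulNr mulrN mulrA !opprK; congr (_ * _).
by rewrite /prefactor expiE -cexpD; congr cexp; field.
Qed.

Lemma theta0 : theta tau 0 = 0.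
Proof.
have := theta_odd 0; rewrite oppr0 => /eqP; rewrite -addr_eq0 -mulr2n.
by rewrite mulrn_eq0 => /eqP.
Qed.

Lemma theta1 z : theta tau (z + 1) = - theta tau z.
Proof.
rewrite !theta_bilateral !half_turn expiD expi1 mulr1 -[in RHS]mulNr; congr (- (_ * _)).
rewrite -mulN1r -cexp_pi /prefactor -cexpD; congr cexp; ring.
Qed.

Lemma theta_tau z :
  theta tau (z + tau) = - cexp (- ('i%C * pi%:C * (tau + 2 * z))) * theta tau z.
Proof.
rewrite !theta_bilateral (_ : z + tau + 2^-1 = tau + (z + 2^-1)); last by ring.
rewrite expiD bilateral_shift ?expi_neq0 // /Q -expiD -expiN (mulrA (prefactor _)) [RHS]mulrN (mulrA (- cexp _)).
congr (- (_ * _)).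
rewrite [RHS]mulNr -[RHS]mulN1r (_ : -1 = cexp (- ('i%C * pi%:C))); last first.
  by rewrite cexpN cexp_pi invrN invr1.
by rewrite /prefactor !expiE -!cexpD; congr cexp; field.
Qed.

Lemma entire_expi_affine (a b : C) : entire (fun z => expi (a * z + b)).
Proof.
have -> : (fun z => expi (a * z + b)) = (fun z => expi (1 * (a * z + b))).
  by apply/funext => z; rewrite mul1r.
exact: entire_comp (entire_expi 1) (entire_affine a b).
Qed.

Arguments entire_expi_affine : clear implicits.

Lemma entire_theta : entire (theta tau).
Proof.
have -> : theta tau = (fun z => -1 * (prefactor z *
   (partial_theta Q (expi (1 * z + 2^-1)) +
    expi ((-1) * z + (- 2^-1)) * partial_theta Q (expi ((-1) * z + (- 2^-1)))))).
  apply/funext => z; rewrite theta_bilateral mulN1r /bilateral mul1r mulN1r.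
  by rewrite -opprD expiN.
have ep : entire prefactor.
  have -> : prefactor = (fun z => cexp ('i%C * pi%:C * z +
                     ('i%C * pi%:C * tau / 4 + 'i%C * pi%:C * 2^-1))).
    by apply/funext => z; rewrite /prefactor; congr cexp; ring.
  exact: entire_comp entire_cexp (entire_affine _ _).
have eA (a b : C) : entire (fun z => partial_theta Q (expi (a * z + b))).
  have eQ : entire (partial_theta Q) := entire_partial_theta modulus_nome.
  exact: entire_comp eQ (entire_expi_affine a b).
apply: (entireM (entire_cst _)); apply: (entireM ep).
exact: entireD (eA _ _) (entireM (entire_expi_affine _ _) (eA _ _)).
Qed.

Lemma theta_eq0_bilateral z : theta tau z = 0 ->
  partial_theta Q (- expi z) + (- expi z)^-1 * partial_theta Q (- expi z)^-1 = 0.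
Proof.
move=> /eqP; rewrite theta_bilateral oppr_eq0 mulf_eq0 (negbTE (cexp_neq0 _)) /=.
by rewrite half_turn => /eqP.
Qed.

End ThetaFunction.
Arguments entire_expi_affine {R} a b.
Arguments entire_theta {R tau} _.

(** * Zeros of the theta function *)

Section FiniteProduct.
Variables (R : realType) (Q : R[i]).
Local Notation C := R[i].
Hypotheses (Q0 : Q != 0) (Q1 : modulus Q < 1).

(** The q-Pochhammer symbol [(Q; Q)_k]. *)
Definition qfact (k : nat) : C := \prod_(i < k) (1 - Q ^+ i.+1).

Lemma one_sub_expr_neq0 k : 1 - Q ^+ k.+1 != 0.
Proof.
rewrite subr_eq0; apply/eqP => /(congr1 (@modulus R)); rewrite modulus1 modulusX => E.
have : modulus Q ^+ k.+1 < 1 by rewrite exprn_ilt1 ?modulus_ge0.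
by rewrite -E ltxx.
Qed.

Lemma qfactS k : qfact k.+1 = qfact k * (1 - Q ^+ k.+1).
Proof. by rewrite /qfact big_ord_recr. Qed.

Lemma qfact_neq0 k : qfact k != 0.
Proof. by apply/prodf_neq0 => i _; exact: one_sub_expr_neq0. Qed.

Definition gauss_binomial (m i : nat) : C := qfact m / (qfact i * qfact (m - i)).

Lemma gauss_binomialS i d :
  gauss_binomial (i + d).+2 i.+1 =
  gauss_binomial (i + d).+1 i.+1 + Q ^+ d.+1 * gauss_binomial (i + d).+1 i.
Proof.
rewrite /gauss_binomial (_ : ((i + d).+2 - i.+1 = d.+1)%N); last by lia.
rewrite (_ : ((i + d).+1 - i.+1 = d)%N); last by lia.
rewrite (_ : ((i + d).+1 - i = d.+1)%N); last by lia.
rewrite (qfactS (i + d).+1) (qfactS i) (qfactS d).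
have -> : Q ^+ (i + d).+2 = Q ^+ i.+1 * Q ^+ d.+1.
  by rewrite -exprD; congr (_ ^+ _); lia.
have := qfact_neq0 i; have := qfact_neq0 d.
have := one_sub_expr_neq0 i; have := one_sub_expr_neq0 d.
move: (qfact i) (qfact d) (qfact _) (Q ^+ d.+1) (Q ^+ i.+1) => a b c u v *.
by field; apply/and4P.
Qed.

Lemma gauss_binomial0 m : gauss_binomial m 0 = 1.
Proof. by rewrite /gauss_binomial subn0 {2}/qfact big_ord0 mul1r divff ?qfact_neq0. Qed.

Lemma gauss_binomialn m : gauss_binomial m m = 1.
Proof. by rewrite /gauss_binomial subnn {3}/qfact big_ord0 mulr1 divff ?qfact_neq0. Qed.

(** The q-binomial theorem (Rothe). *)
Lemma qbinomial m (y : C) :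
  \prod_(k < m) (1 + y * Q ^+ k) =
  \sum_(i < m.+1) gauss_binomial m i * Q ^+ 'C(i, 2) * y ^+ i.
Proof.
elim: m => [|m IH].
  by rewrite big_ord0 big_ord_recl big_ord0 gauss_binomial0 /= !expr0; ring.
rewrite big_ord_recr /= IH mulrDr mulr1.
rewrite [in RHS]big_ord_recl [in RHS]big_ord_recr /=.
rewrite [X in X + _]big_ord_recl [X in _ + X * _]big_ord_recr /=.
rewrite !gauss_binomial0 !gauss_binomialn mulrDl -!addrA; congr (_ + _).
rewrite !addrA; congr (_ + _); last first.
  by rewrite /bump /= add1n binS bin1 !exprD exprS; ring.
rewrite mulr_suml -big_split /=; apply: eq_bigr => i _.
rewrite /bump /= !add1n; move: (nat_of_ord i) (ltn_ord i) => {}i im.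
have [d ->] : exists d, m = (i + d).+1 by exists (m - i.+1)%N; lia.
rewrite gauss_binomialS binS bin1 exprD !exprS exprD.
move: (gauss_binomial _ i.+1) (gauss_binomial _ i) (Q ^+ i) (Q ^+ d) (y ^+ i) => *; ring.
Qed.

Definition finite_triple (x : C) (N : nat) : C :=
  \prod_(k < N) (1 + x * Q ^+ k.+1) * \prod_(k < N.+1) (1 + x^-1 * Q ^+ k).

Definition triple_coef (N j : nat) : C :=
  qfact (N + N).+1 / (qfact (N - j) * qfact (N + j).+1).

Let bin2_sub j d : ('C(d, 2) + 'C((j + d).+1, 2) = 'C(j.+1, 2) + (j + d) * d)%N.
Proof.
elim: d => [|d IH]; first by rewrite bin0n muln0 !addn0.
rewrite addnS [in LHS]binS bin1 [in LHS]binS bin1; lia.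
Qed.

Let bin2_add j N : ('C((N + j).+1, 2) + 'C(N.+1, 2) = 'C(j.+1, 2) + N * (N + j).+1)%N.
Proof.
elim: N => [|N IH]; first by rewrite add0n (@bin_small 1 2) // mul0n !addn0.
rewrite addSn [in LHS]binS bin1 [in X in (_ + X)%N]binS bin1; lia.
Qed.

(** The q-binomial theorem for [2 N + 1] factors, centred by the substitution
    [y = x^-1 Q^-N]: the terms of index [N - j] and [N + 1 + j] have the same
    coefficient and are grouped together. *)
Lemma finite_tripleE (x : C) (N : nat) : x != 0 ->
  finite_triple x N =
  \sum_(j < N.+1) triple_coef N j * (Q ^+ 'C(j.+1, 2) * (x ^+ j + x^-1 * x^-1 ^+ j)).
Proof.
move=> x0; pose y := x^-1 * Q ^- N.
have QN k : Q ^+ k != 0 by rewrite expf_neq0.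
pose c := x ^+ N * Q ^+ 'C(N.+1, 2).
have prodE : finite_triple x N = c * \prod_(k < (N + N.+1)) (1 + y * Q ^+ k).
  rewrite big_split_ord /= mulrA; congr (_ * _); last first.
    by apply: eq_bigr => k _; rewrite /y exprD; field; rewrite x0 QN.
  have -> : c = \prod_(k < N) (x * Q ^+ k.+1).
    rewrite /c; elim: (N) => [|m IH]; first by rewrite big_ord0 bin_small // !expr0 mulr1.
    by rewrite big_ord_recr /= -IH (binS m.+1) bin1 exprD [x ^+ m.+1]exprS; ring.
  rewrite [X in _ * X](reindex_inj rev_ord_inj) /= -big_split /=.
  apply: eq_bigr => k _; rewrite /y.
  have -> : Q ^+ N = Q ^+ (N - k.+1) * Q ^+ k.+1 by rewrite -exprD subnK.
  by field; rewrite x0 !QN.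
rewrite prodE addnS qbinomial mulr_sumr.
rewrite (_ : (N + N).+2 = N.+1 + N.+1)%N; last by rewrite addSn addnS.
rewrite big_split_ord /= (reindex_inj rev_ord_inj) /= -big_split /=.
have cy i e : ('C(i, 2) + 'C(N.+1, 2) = e + N * i)%N ->
    c * (Q ^+ 'C(i, 2) * y ^+ i) = Q ^+ e * (x ^+ N * x^-1 ^+ i).
  move=> E; rewrite /c /y exprMn -[Q ^- N]exprVn -exprM [Q^-1 ^+ _]exprVn.
  transitivity (x ^+ N * x^-1 ^+ i * (Q ^+ ('C(i, 2) + 'C(N.+1, 2)) / Q ^+ (N * i))).
    by rewrite exprD; ring.
  by rewrite E exprD mulfK ?QN // mulrC.
apply: eq_bigr => j _; have jN : (j <= N)%N by rewrite -ltnS.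
rewrite !subSS mulrDr mulrDr; congr (_ + _).
  rewrite -mulrA mulrCA (@cy _ 'C(j.+1, 2)); last first.
    by have := bin2_sub j (N - j); rewrite subnKC.
  rewrite /gauss_binomial /triple_coef.
  rewrite (_ : ((N + N).+1 - (N - j) = (N + j).+1)%N); last by lia.
  congr (_ * (_ * _)); rewrite -{1}(subnK jN) exprD exprVn.
  by rewrite mulrAC divff ?mul1r // expf_neq0.
rewrite -mulrA mulrCA (@cy _ 'C(j.+1, 2)) addSn; last exact: bin2_add.
rewrite /gauss_binomial /triple_coef.
rewrite (_ : ((N + N).+1 - (N + j).+1 = N - j)%N); last by lia.
congr (_ * (_ * _)); first by rewrite [X in _ / X]mulrC.
by rewrite exprS exprD mulrCA [x ^+ N * _]mulrA exprVn divff ?mul1r // expf_neq0.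
Qed.

End FiniteProduct.

Section ProductBounds.
Variables (R : realType) (rho : R).
Local Notation C := R[i].
Hypothesis rho01 : 0 <= rho < 1.

Lemma geometric_sum_le m n :
  \sum_(m <= k < m + n) rho ^+ k <= rho ^+ m / (1 - rho).
Proof.
have /andP[r0 r1] := rho01; have d0 : 0 < 1 - rho by lra.
rewrite ler_pdivlMr //.
suff -> : (\sum_(m <= k < m + n) rho ^+ k) * (1 - rho) = rho ^+ m - rho ^+ (m + n).
  by rewrite lerBlDr lerDl exprn_ge0.
elim: n => [|n IH]; first by rewrite addn0 big_geq // mul0r subrr.
by rewrite addnS big_nat_recr ?leq_addr //= mulrDl IH exprS; ring.
Qed.

Lemma prod_upper (a : nat -> C) (A : R) : 0 <= A ->
  (forall k, modulus (a k) <= A * rho ^+ k) ->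
  exists2 U : R, 0 < U & forall m, modulus (\prod_(k < m) (1 + a k)) <= U.
Proof.
move=> A0 aA; exists (expR (A / (1 - rho))); first exact: expR_gt0.
move=> m; apply: (@le_trans _ _ (expR (\sum_(k < m) A * rho ^+ k))).
  elim: m => [|m IH]; first by rewrite !big_ord0 modulus1 expR0.
  rewrite !big_ord_recr /= modulusM expRD; apply: ler_pM; rewrite ?modulus_ge0 //.
  apply: (le_trans (modulusD _ _)); rewrite modulus1.
  by apply: le_trans (expR_ge1Dx _); rewrite lerD2l.
rewrite ler_expR -mulr_sumr; apply: ler_wpM2l => //.
have := geometric_sum_le 0 m; rewrite add0n big_mkord expr0.
by rewrite div1r.
Qed.

(** Past some index [J] the factors are so close to 1 that their product is at
    least 1/2. *)
Lemma prod_lower (a : nat -> C) (A : R) : 0 <= A ->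
  (forall k, modulus (a k) <= A * rho ^+ k) -> (forall k, 1 + a k != 0) ->
  exists2 c : R, 0 < c & forall m, c <= modulus (\prod_(k < m) (1 + a k)).
Proof.
have /andP[r0 r1] := rho01; have d0 : 0 < 1 - rho by lra.
move=> A0 aA a0; pose f k := Num.min 1 (modulus (1 + a k)).
have f0 k : 0 < f k by rewrite lt_min ltr01 modulus_gt0 a0.
have f1 k : f k <= 1 by rewrite ge_min lexx.
have fa k : 1 - A * rho ^+ k <= f k.
  rewrite le_min gerBl mulr_ge0 ?exprn_ge0 //=.
  have := modulusD (1 + a k) (- a k); rewrite addrK modulus1 modulusN.
  have := aA k; lra.
have [J HJ] : exists J, A * rho ^+ J / (1 - rho) <= 2^-1.
  have e0 : 0 < (1 - rho) / (2 * (A + 1)) by rewrite divr_gt0 // mulr_gt0 //; lra.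
  have [J HJ] := expr_small rho01 e0; exists J.
  rewrite ler_pdivrMr //; have := HJ J (leqnn _).
  rewrite ler_pdivlMr; last by rewrite mulr_gt0 //; lra.
  have : 0 <= rho ^+ J by rewrite exprn_ge0.
  move: (rho ^+ J) => t; lra.
pose g m := \prod_(k < m) f k.
have g0 m : 0 < g m by apply: prodr_gt0 => k _.
have gS m : g m.+1 = g m * f m by rewrite /g big_ord_recr.
have gle m n : g (m + n)%N <= g m.
  elim: n => [|n IH]; first by rewrite addn0.
  by rewrite addnS gS; apply: le_trans IH; rewrite ler_piMr // ltW.
have glow n : (1 - A * \sum_(J <= k < J + n) rho ^+ k) * g J <= g (J + n)%N.
  elim: n => [|n IH]; first by rewrite addn0 big_geq // mulr0 subr0 mul1r.
  rewrite addnS gS big_nat_recr ?leq_addr //=.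
  set s := \sum_(_ <= k < _) _ in IH *; set r := rho ^+ (J + n).
  have s0 : 0 <= s by apply: sumr_ge0 => k _; rewrite exprn_ge0.
  have h1 : 1 - A * r <= f (J + n)%N := fa _.
  have h2 := g0 J; have h3 := g0 (J + n)%N; have h4 := f1 (J + n)%N.
  have h5 := gle J n; have rr : 0 <= r by rewrite exprn_ge0.
  apply: (@le_trans _ _ (g (J + n)%N * (1 - A * r))); last by rewrite ler_pM2l.
  have : g (J + n)%N * (A * r) <= g J * (A * r) by rewrite ler_wpM2r // mulr_ge0.
  move: IH; move: (g (J + n)%N) (g J) => x y; lra.
exists (g J / 2); first by rewrite divr_gt0.
have gfin m : g J / 2 <= g m.
  have [le_mJ|/ltnW le_Jm] := leqP m J.
    have := gle m (J - m)%N; rewrite subnKC //; have := g0 J.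
    by move: (g J) (g m) => x y; lra.
  have := glow (m - J)%N; rewrite subnKC // => H; apply: le_trans H.
  rewrite mulrC; apply: ler_wpM2r; first exact: ltW.
  have := geometric_sum_le J (m - J); rewrite subnKC // => H.
  have : A * \sum_(J <= k < m) rho ^+ k <= 2^-1.
    by apply: le_trans HJ; rewrite -mulrA; apply: ler_wpM2l.
  by move: (A * \sum_(_ <= k < _) _) => y; lra.
move=> m; apply: (le_trans (gfin m)); rewrite modulus_prod /g.
by apply: ler_prod => k _; rewrite ltW //= ge_min lexx orbT.
Qed.

End ProductBounds.

Section NonVanishing.
Variables (R : realType) (Q : R[i]).
Local Notation C := R[i].
Hypotheses (Q0 : Q != 0) (Q1 : modulus Q < 1).
Let rho := modulus Q.

Let rho01 : 0 <= rho < 1.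
Proof. by rewrite /rho modulus_ge0. Qed.

Let rho0 : 0 < rho.
Proof. by rewrite modulus_gt0. Qed.

Lemma qfact_bounds : exists c U : R, [/\ 0 < c, 0 < U,
  forall k, c <= modulus (qfact Q k) & forall k, modulus (qfact Q k) <= U].
Proof.
have bd k : modulus (- Q ^+ k.+1) <= 1 * rho ^+ k.
  rewrite modulusN modulusX mul1r exprS ler_piMl ?exprn_ge0 ?modulus_ge0 //.
  exact: ltW.
have [U U0 HU] := prod_upper rho01 ler01 bd.
have [c c0 Hc] := prod_lower rho01 ler01 bd (one_sub_expr_neq0 Q1).
by exists c, U; split.
Qed.

Lemma qfact_cauchy : exists2 D : R, 0 <= D &
  forall k m n, (k <= m)%N -> (k <= n)%N -> modulus (qfact Q m - qfact Q n) <= D * rho ^+ k.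
Proof.
have [c [U [c0 U0 _ HU]]] := qfact_bounds.
have /andP[r0 r1] := rho01; have d0 : 0 < 1 - rho by lra.
have step k m : modulus (qfact Q (k + m) - qfact Q k) <= U * (rho ^+ k / (1 - rho)).
  apply: (@le_trans _ _ (U * \sum_(k <= i < k + m) rho ^+ i)); last first.
    by apply: ler_wpM2l; [exact: ltW|exact: geometric_sum_le].
  elim: m => [|m IH]; first by rewrite addn0 subrr modulus0 big_geq // mulr0.
  rewrite addnS big_nat_recr ?leq_addr //= mulrDr qfactS.
  rewrite (_ : _ - _ = (qfact Q (k + m) - qfact Q k) - qfact Q (k + m) * Q ^+ (k + m).+1);
    last by ring.
  apply: (le_trans (modulusD _ _)); apply: lerD => //.
  rewrite modulusN modulusM modulusX; apply: ler_pM; rewrite ?exprn_ge0 ?modulus_ge0 //.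
  by rewrite exprS ler_piMl ?exprn_ge0 ?modulus_ge0 // ltW.
exists (2 * U / (1 - rho)); first by rewrite divr_ge0 ?mulr_ge0 // ltW.
move=> k m n km kn; have H1 := step k (m - k)%N; have H2 := step k (n - k)%N.
rewrite !subnKC // in H1 H2.
have -> : qfact Q m - qfact Q n = (qfact Q m - qfact Q k) - (qfact Q n - qfact Q k) by ring.
apply: (le_trans (modulusD _ _)); rewrite modulusN.
by apply: (le_trans (lerD H1 H2)); rewrite le_eqVlt; apply/orP; left; apply/eqP; ring.
Qed.

(** The coefficients differ from a common value by errors that are small where
    the terms of the series are large. *)
Lemma triple_coef_cauchy : exists2 D : R, 0 <= D &
  forall N j, (j <= N)%N ->
    modulus (triple_coef Q N j - triple_coef Q N 0) <= D * rho ^+ (N - j).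
Proof.
have [c [U [c0 U0 Hc HU]]] := qfact_bounds; have [D D0 HD] := qfact_cauchy.
exists (U * (2 * U * D) / c ^+ 4).
  by rewrite divr_ge0 ?exprn_ge0 ?mulr_ge0 // ltW.
move=> N j jN; rewrite /triple_coef subn0 addn0.
have := HD (N - j)%N N (N - j)%N (leq_subr _ _) (leqnn _).
have := HD (N - j)%N N.+1 (N + j).+1 ltac:(lia) ltac:(lia).
have := Hc (N - j)%N; have := Hc (N + j).+1; have := Hc N; have := Hc N.+1.
have := HU (N + N).+1; have := HU N; have := HU (N + j).+1.
have := qfact_neq0 Q1 (N - j); have := qfact_neq0 Q1 (N + j).+1.
have := qfact_neq0 Q1 N; have := qfact_neq0 Q1 N.+1.
set P := qfact Q (N + N).+1; set a := qfact Q (N - j); set b := qfact Q (N + j).+1.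
set a0 := qfact Q N; set b0 := qfact Q N.+1; set r := rho ^+ _.
move=> b0n a0n bn an Ub Ua0 UP cb0 ca0 cb ca Db Da.
rewrite (_ : _ - _ = P * (a0 * (b0 - b) + b * (a0 - a)) / (a * b * a0 * b0)); last first.
  by field; rewrite an bn a0n b0n.
have r0 : 0 <= r by rewrite exprn_ge0 // ltW.
have num : modulus (P * (a0 * (b0 - b) + b * (a0 - a))) <= U * (2 * U * D) * r.
  rewrite modulusM -[leRHS]mulrA; apply: ler_pM; rewrite ?modulus_ge0 //.
  apply: (le_trans (modulusD _ _)); rewrite !modulusM.
  rewrite (_ : 2 * U * D * r = U * (D * r) + U * (D * r)); last by ring.
  by apply: lerD; apply: ler_pM; rewrite ?modulus_ge0.
have den : c ^+ 4 <= modulus (a * b * a0 * b0).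
  rewrite !modulusM !exprSr expr0 mul1r.
  by do !(apply: ler_pM; rewrite ?mulr_ge0 ?(ltW c0) //).
have den0 : 0 < modulus (a * b * a0 * b0) by rewrite modulus_gt0 !mulf_neq0.
have {}den : 1 <= modulus (a * b * a0 * b0) / c ^+ 4.
  by rewrite ler_pdivlMr ?exprn_gt0 // mul1r.
rewrite modulusM modulusV ler_pdivrMr //.
rewrite [leRHS](_ : _ = U * (2 * U * D) * r * (modulus (a * b * a0 * b0) / c ^+ 4)); last by ring.
rewrite -[leLHS]mulr1; apply: ler_pM; rewrite ?modulus_ge0 //.
Qed.


(** At a zero of the bilateral series the finite products would tend to 0, since
    their coefficients are nearly constant; but they stay away from 0 when no
    factor vanishes. *)
Lemma bilateral_neq0 (x : C) : x != 0 ->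
  (forall k, 1 + x * Q ^+ k.+1 != 0) -> (forall k, 1 + x^-1 * Q ^+ k != 0) ->
  partial_theta Q x + x^-1 * partial_theta Q x^-1 != 0.
Proof.
move=> x0 fac1 fac2; apply/eqP => zero.
have [D D0 HD] := triple_coef_cauchy.
have [c [U [c0 U0 Hc HU]]] := qfact_bounds.
have [M HM] := partial_theta_bound Q1 x; have [M' HM'] := partial_theta_bound Q1 x^-1.
pose t j : C := Q ^+ 'C(j.+1, 2) * (x ^+ j + x^-1 * x^-1 ^+ j).
have S0 N : modulus (\sum_(j < N) t j) <= (2 * M + modulus x^-1 * (2 * M')) * 2^-1 ^+ N.
  rewrite (_ : \sum_(j < N) t j = - (
     (partial_theta Q x - \sum_(0 <= j < N) partial_theta_coef Q j * x ^+ j) +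
     x^-1 * (partial_theta Q x^-1 - \sum_(0 <= j < N) partial_theta_coef Q j * x^-1 ^+ j))).
    rewrite modulusN; apply: (le_trans (modulusD _ _)); rewrite modulusM [leRHS]mulrDl.
    apply: lerD; first exact: csum_approx.
    by rewrite -mulrA; apply: ler_wpM2l; [exact: modulus_ge0|exact: csum_approx].
  rewrite mulrBr addrACA zero add0r -opprD opprK mulr_sumr -big_split /= big_mkord.
  by apply: eq_bigr => j _; rewrite /t /partial_theta_coef; ring.
(* The terms must decay faster than [rho ^ j] to absorb the coefficient errors
   [rho ^ (N - j)]. *)
have bnd (y : C) : y != 0 -> exists L, forall j,
    modulus (partial_theta_coef Q j * y ^+ j) <= L * (rho ^+ j * 2^-1 ^+ j).
  rewrite -modulus_gt0 => y0.
  have [|L HL] := entire_partial_theta_coef Q1 (r := 2 * modulus y / rho).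
    by rewrite divr_gt0 // mulr_gt0.
  exists L => j; rewrite modulusM modulusX.
  have rj : 0 < rho ^+ j * 2^-1 ^+ j by rewrite mulr_gt0 ?exprn_gt0.
  rewrite -ler_pdivrMr //; apply: le_trans (HL j).
  rewrite -[leLHS]mulrA; apply: ler_wpM2l; first exact: modulus_ge0.
  rewrite -exprMn -expr_div_n le_eqVlt; apply/orP; left; apply/eqP.
  by congr (_ ^+ _); field; rewrite gt_eqF.
have [L1 HL1] := bnd x x0; have [L2 HL2] := bnd x^-1 (invr_neq0 x0).
pose L := L1 + modulus x^-1 * L2.
have tL j : modulus (t j) <= L * (rho ^+ j * 2^-1 ^+ j).
  rewrite /t (_ : _ * _ = partial_theta_coef Q j * x ^+ j +
    x^-1 * (partial_theta_coef Q j * x^-1 ^+ j)); last by rewrite /partial_theta_coef; ring.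
  apply: (le_trans (modulusD _ _)); rewrite (modulusM x^-1) [leRHS]mulrDl; apply: lerD => //.
  by rewrite -mulrA; apply: ler_wpM2l; rewrite ?modulus_ge0.
have L0 : 0 <= L.
  by have := tL 0%N; rewrite !expr0 !mulr1; apply: le_trans; exact: modulus_ge0.
set K := _ + _ in S0.
have K0 : 0 <= K.
  by have := S0 0%N; rewrite expr0 mulr1; apply: le_trans; exact: modulus_ge0.
have [c1 c10 Hc1] : exists2 c1 : R, 0 < c1 & forall m, c1 <= modulus (\prod_(k < m) (1 + x * Q ^+ k.+1)).
  apply: (@prod_lower _ _ rho01 (fun k => x * Q ^+ k.+1) (modulus x)) => // [|k].
    exact: modulus_ge0.
  rewrite modulusM modulusX; apply: ler_wpM2l; first exact: modulus_ge0.
  by rewrite exprS ler_piMl ?exprn_ge0 ?modulus_ge0 // ltW.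
have [c2 c20 Hc2] : exists2 c2 : R, 0 < c2 & forall m, c2 <= modulus (\prod_(k < m) (1 + x^-1 * Q ^+ k)).
  apply: (@prod_lower _ _ rho01 (fun k => x^-1 * Q ^+ k) (modulus x^-1)) => // [|k].
    exact: modulus_ge0.
  by rewrite modulusM modulusX.
have lower N : c1 * c2 <= modulus (finite_triple Q x N).
  by rewrite /finite_triple modulusM; apply: ler_pM => //; exact: ltW.
pose E1 := 2 * D * L + 1; pose E2 := U / c ^+ 2 * K + 1.
have E10 : 0 < E1 by rewrite /E1 ltr_wpDl // !mulr_ge0.
have E20 : 0 < E2 by rewrite /E2 ltr_wpDl // mulr_ge0 // divr_ge0 ?exprn_ge0 // ltW.
have upper N : modulus (finite_triple Q x N) <= E1 * rho ^+ N + E2 * 2^-1 ^+ N.+1.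
  have hN : 0 <= 2^-1 ^+ N.+1 :> R by rewrite exprn_ge0.
  have hr : 0 <= rho ^+ N by rewrite exprn_ge0 // modulus_ge0.
  have -> : finite_triple Q x N =
      \sum_(j < N.+1) (triple_coef Q N j - triple_coef Q N 0) * t j +
      triple_coef Q N 0 * \sum_(j < N.+1) t j.
    rewrite finite_tripleE // mulr_sumr -big_split /=; apply: eq_bigr => j _.
    by rewrite -mulrDl subrK.
  apply: (le_trans (modulusD _ _)); apply: lerD.
    apply: (le_trans (modulus_sum _ _ _)).
    apply: (@le_trans _ _ (\sum_(j < N.+1) D * L * rho ^+ N * 2^-1 ^+ j)).
      apply: ler_sum => j _; have jN : (j <= N)%N by rewrite -ltnS.
      rewrite modulusM.
      rewrite (_ : D * L * rho ^+ N * 2^-1 ^+ j =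
                   D * rho ^+ (N - j) * (L * (rho ^+ j * 2^-1 ^+ j))); last first.
        by rewrite -{1}(subnK jN) exprD; ring.
      by apply: ler_pM; rewrite ?modulus_ge0 // HD.
    rewrite -mulr_sumr (_ : E1 * rho ^+ N = D * L * rho ^+ N * 2 + rho ^+ N);
      last by rewrite /E1; ring.
    rewrite -[leLHS]addr0; apply: lerD => //; apply: ler_wpM2l; first by rewrite !mulr_ge0.
    have h01 : 0 <= (2^-1 : R) < 1 by lra.
    have := geometric_sum_le h01 0 N.+1; rewrite add0n expr0 big_mkord.
    by have -> : 1 / (1 - 2^-1) = 2 :> R by field.
  rewrite modulusM [leRHS]mulrDl mul1r -[leLHS]addr0; apply: lerD => //.
  rewrite -mulrA; apply: ler_pM; rewrite ?modulus_ge0 //.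
  rewrite /triple_coef modulusM modulusV modulusM subn0 addn0.
  apply: ler_pM; rewrite ?invr_ge0 ?mulr_ge0 ?modulus_ge0 //.
  rewrite lef_pV2 ?posrE ?exprn_gt0 ?mulr_gt0 ?modulus_gt0 ?qfact_neq0 //.
  by rewrite expr2; apply: ler_pM; rewrite ?(ltW c0).
have c12 : 0 < c1 * c2 by rewrite mulr_gt0.
have e1 : 0 < c1 * c2 / (4 * E1) by rewrite divr_gt0 // mulr_gt0.
have e2 : 0 < c1 * c2 / (4 * E2) by rewrite divr_gt0 // mulr_gt0.
have h01 : 0 <= (2^-1 : R) < 1 by lra.
have [N1 HN1] := expr_small rho01 e1; have [N2 HN2] := expr_small h01 e2.
have := HN1 (maxn N1 N2) (leq_maxl _ _).
have := HN2 (maxn N1 N2).+1 (leqW (leq_maxr _ _)).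
have := lower (maxn N1 N2); have := upper (maxn N1 N2).
rewrite !ler_pdivlMr ?mulr_gt0 //.
move: (modulus _) (rho ^+ _) (2^-1 ^+ _) => a b d; lra.
Qed.

End NonVanishing.

Section ThetaZeros.
Variables (R : realType) (tau : R[i]).
Local Notation C := R[i].
Hypothesis tau_gt0 : 0 < complex.Im tau.

(** The modulus gives [Im w = 0]; reducing [Re w] modulo 1 to [f] in [0, 1),
    [cos (2 pi f) = 1] forces [sin (pi f) = 0], hence [f = 0]. *)
Lemma expi_eq1 (w : C) : expi w = 1 -> exists m : int, w = m%:~R.
Proof.
move=> w1; have Im0 : complex.Im w = 0.
  have := congr1 (@modulus R) w1; rewrite expiE modulus_cexp modulus1 -[RHS]expR0 => /expR_inj/eqP.
  rewrite (_ : 2 * pi%:C * 'i%C * w = (2 * pi)%:C * ('i%C * w)); last first.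
    by rewrite rmorphM /= rmorph_nat; ring.
  rewrite ReZ ReM /= mul0r sub0r mul1r mulrN oppr_eq0 !mulf_eq0.
  by rewrite pnatr_eq0 (gt_eqF (pi_gt0 R)) => /eqP.
pose t := complex.Re w; have wt : w = t%:C.
  by apply: complex_eq.
pose m := Num.floor t; exists m.
have /andP[m1 m2] := floor_itv t; rewrite -/m in m1 m2.
pose f := t - m%:~R; have f0 : 0 <= f by rewrite subr_ge0.
have f1 : f < 1 by rewrite /f ltrBlDl -(intrD _ m 1).
have ef : expi f%:C = 1.
  by rewrite /f rmorphB /= rmorph_int expiD -wt w1 -[- _%:~R]rmorphN expi_int mulr1.
have := ef; rewrite expi_real => /(congr1 (@complex.Re R)) /= cosf.
have sinf : sin (pi * f) = 0.
  have : cos (pi * f + pi * f) = 1 by rewrite -cosf; congr cos; ring.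
  rewrite cosD -!expr2 cos2sin2 => E; apply/eqP; rewrite -sqrf_eq0; apply/eqP.
  by move: (sin _ ^+ 2) E => s2; lra.
have [fz|fnz] := eqVneq f 0.
  by rewrite wt -[t](subrK m%:~R) -/f fz add0r rmorph_int.
have : 0 < sin (pi * f).
  apply: sin_gt0_pi; have fpos : 0 < f by rewrite lt_def fnz.
  by rewrite mulr_gt0 ?pi_gt0 //= gtr_pMr // pi_gt0.
by rewrite sinf ltxx.
Qed.

Lemma theta_neq0 (z : C) : ~ lattice tau z -> theta tau z != 0.
Proof.
move=> z_notin; apply/eqP => /(theta_eq0_bilateral tau_gt0); apply/eqP.
have Q1 := modulus_nome tau_gt0; have Q0 : expi tau != 0 := expi_neq0 _.
have expX w k : expi w ^+ k = expi (k%:R * w).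
  by elim: k => [|k IH]; rewrite ?mul0r ?expi0 // exprSr IH -natr1 mulrDl mul1r expiD.
apply: bilateral_neq0 => //; first by rewrite oppr_eq0 expi_neq0.
- move=> k; rewrite mulNr subr_eq0 eq_sym; apply/eqP; rewrite expX -expiD => /expi_eq1[m E].
  apply: z_notin; exists m, (- k.+1%:Z).
  by rewrite rmorphN /= -E -[(Posz k.+1)%:~R]/(k.+1%:R : C); ring.
move=> k; rewrite invrN mulNr subr_eq0 eq_sym; apply/eqP.
rewrite -expiN expX -expiD => /expi_eq1[m E].
apply: z_notin; exists (- m), k%:Z.
by rewrite rmorphN /= -E -[(Posz k)%:~R]/(k%:R : C); ring.
Qed.

End ThetaZeros.

(** * Theta spaces and the transfer matrix *)

Section ThetaSpaces.
Variables (R : realType) (tau : R[i]).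
Local Notation C := R[i].
Hypothesis tau_gt0 : 0 < complex.Im tau.
Variable n : nat.

(** The factor by which the shift by [tau] acts in degree [n], up to a constant. *)
Definition automorphy (z : C) : C := cexp (- ('i%C * pi%:C * n%:R * (tau + 2 * z))).

Definition theta_space (B : C) (f : C -> C) : Prop :=
  [/\ entire f, forall z, f (z + 1) = (-1) ^+ n * f z &
      forall z, f (z + tau) = B * automorphy z * f z].

Lemma cexp_sum (I : Type) (r : seq I) (P : pred I) (F : I -> C) :
  cexp (\sum_(i <- r | P i) F i) = \prod_(i <- r | P i) cexp (F i).
Proof. by apply: big_morph; [exact: cexpD|exact: cexp0]. Qed.

(** The laws for the two generators 1 and [tau] of the lattice compose to the law
    for all lattice vectors; the cross term [2 pi i n r s] is a period of the
    exponential. *)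
Lemma Theta_of_generators (f : C -> C) (a b : C) :
  (forall z, f (z + 1) = cexp a * f z) ->
  (forall z, f (z + tau) = cexp b * automorphy z * f z) ->
  forall (r s : int) z, f (z + r%:~R + s%:~R * tau) =
    cexp (r%:~R * a + s%:~R * b)
    * cexp (- (pi%:C * 'i%C * n%:R * (s%:~R ^+ 2 * tau + 2 * s%:~R * z))) * f z.
Proof.
move=> f1 ft r s z.
have fr (k : int) w : f (w + k%:~R) = cexp (k%:~R * a) * f w.
  have step (m : int) : f (w + (m + 1)%:~R) = cexp a * f (w + m%:~R).
    by rewrite -f1 rmorphD /= addrA.
  elim: k => [|k IH|k IH]; first by rewrite addr0 mul0r cexp0 mul1r.
    rewrite -addn1 PoszD step IH mulrA -cexpD; congr (cexp _ * _).
    by rewrite rmorphD /=; ring.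
  apply: (mulfI (cexp_neq0 a)); rewrite -step -addn1 PoszD opprD addrK IH mulrA -cexpD.
  by congr (cexp _ * _); rewrite rmorphB /=; ring.
pose e (k : int) (w : C) : C :=
  k%:~R * b - pi%:C * 'i%C * n%:R * (k%:~R ^+ 2 * tau + 2 * k%:~R * w).
have fs (k : int) w : f (w + k%:~R * tau) = cexp (e k w) * f w.
  have step (m : int) : f (w + (m + 1)%:~R * tau) =
      cexp (e (m + 1) w - e m w) * f (w + m%:~R * tau).
    rewrite rmorphD /= mulrDl mul1r addrA ft /automorphy -cexpD; congr (cexp _ * _).
    by rewrite /e rmorphD /=; ring.
  elim: k => [|k IH|k IH].
  - by rewrite /e mul0r addr0 (_ : _ - _ = 0) ?cexp0 ?mul1r //; ring.
  - by rewrite -addn1 PoszD step IH mulrA -cexpD subrK.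
  have H := step (- k.+1%:Z); rewrite (_ : - k.+1%:Z + 1 = - k%:Z) in H; last by lia.
  apply: (mulfI (cexp_neq0 (e (- k%:Z) w - e (- k.+1%:Z) w))).
  by rewrite -H IH mulrA -cexpD subrK.
rewrite fs fr mulrA -cexpD; congr (_ * _).
rewrite (_ : e s (z + r%:~R) + r%:~R * a = r%:~R * a + s%:~R * b +
   - (pi%:C * 'i%C * n%:R * (s%:~R ^+ 2 * tau + 2 * s%:~R * z)) +
   2 * pi%:C * 'i%C * (- (n%:Z * s * r))%:~R); last first.
  by rewrite /e rmorphN !rmorphM /= -[n%:~R]/(n%:R : C); ring.
by rewrite cexpD -expiE expi_int mulr1 cexpD.
Qed.

Lemma theta_prod_space (y : 'I_n -> C) :
  theta_space ((-1) ^+ n * cexp (- (2 * pi%:C * 'i%C * \sum_j y j)))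
    (fun z => \prod_j theta tau (z + y j)).
Proof.
split.
- apply: entire_prod => j _.
  have -> : (fun z => theta tau (z + y j)) = (fun z => theta tau (1 * z + y j)).
    by apply/funext => z; rewrite mul1r.
  exact: entire_comp (entire_theta tau_gt0) (entire_affine 1 (y j)).
- move=> z; rewrite (eq_bigr (fun j => - theta tau (z + y j))); last first.
    by move=> j _; rewrite addrAC theta1.
  by rewrite prodrN card_ord.
move=> z; rewrite (eq_bigr (fun j => - (cexp (- ('i%C * pi%:C * (tau + 2 * (z + y j)))) *
    theta tau (z + y j)))); last first.
  by move=> j _; rewrite addrAC theta_tau // mulNr.
rewrite prodrN card_ord big_split /= -cexp_sum mulrA; congr (_ * _).
rewrite /automorphy -[RHS]mulrA -cexpD; congr (_ * cexp _).
rewrite sumrN -mulr_sumr big_split /= sumr_const card_ord -mulr_sumr big_split /=.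
rewrite sumr_const card_ord -(mulr_natl tau) -(mulr_natl z); ring.
Qed.

(** For odd [n] the functions are antiperiodic; the factor [exp (- i pi z)] makes
    them functions on the cylinder. *)
Lemma theta_interpolation (B : C) (L : 'I_n -> C -> C) (x : 'I_n -> C) (f : C -> C) :
  odd n -> B != 0 -> (forall i, theta_space B (L i)) -> theta_space B f ->
  (forall i j, L i (x j) = (i == j)%:R) -> forall z, f z = \sum_i f (x i) * L i z.
Proof.
move=> n_odd B0 lL lf Lx z.
pose K := B * cexp (- ('i%C * pi%:C * n.+1%:R * tau)).
have K0 : K != 0 by rewrite mulf_neq0 ?cexp_neq0.
pose twist (k : C) (z : C) : C := cexp (- ('i%C * pi%:C) * z + k).
have untwist g k : theta_space B g -> quasi_periodic tau n K (fun z => g z * twist k z).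
  move=> [eg g1 gt]; split.
  - apply: (entireM eg).
    exact: entire_comp entire_cexp (entire_affine _ _).
  - move=> w; rewrite g1 -signr_odd n_odd expr1 /twist mulrDr mulr1 addrAC cexpD cexpN cexp_pi.
    by rewrite invrN invr1; ring.
  move=> w; rewrite gt /K; set q := cexp (- _).
  transitivity (B * g w * (automorphy w * twist k (w + tau))); first by ring.
  transitivity (B * g w * (q * expi (- (n%:R * w)) * twist k w)); last by ring.
  congr (B * g w * _); rewrite /q.
  rewrite /automorphy /twist expiE -!cexpD; congr cexp; rewrite -natr1; ring.
have n0 : (0 < n)%N by case: (n) n_odd.
pose k i := 'i%C * pi%:C * x i.
have tw0 i : twist (k i) (x i) = 1 by rewrite /twist /k mulNr addNr cexp0.
have Lx' i j : L i (x j) * twist (k i) (x j) = (i == j)%:R.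
  rewrite Lx; have [->|_] := eqVneq i j; first by rewrite tw0 mulr1.
  by rewrite mul0r.
have := interpolation K0 n0 (fun i => untwist _ (k i) (lL i)) Lx' (untwist f 0 lf) z.
move=> H; apply: (mulIf (cexp_neq0 (- ('i%C * pi%:C) * z + 0))).
rewrite -/(twist 0 z) H mulr_suml; apply: eq_bigr => i _; rewrite /twist /k.
transitivity (f (x i) * L i z * (cexp (- ('i%C * pi%:C) * x i + 0) *
   cexp (- ('i%C * pi%:C) * z + 'i%C * pi%:C * x i))); first by ring.
rewrite -cexpD; congr (_ * cexp _); ring.
Qed.

End ThetaSpaces.

Section Sites.
Variables (R : realType) (tau eta : R[i]) (n : nat) (z : 'I_n -> R[i]).
Local Notation C := R[i].
Hypothesis tau_gt0 : 0 < complex.Im tau.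
Hypothesis n_odd : odd n.
Hypothesis eta_generic : forall k : nat, odd k -> (1 <= k <= n)%N ->
  ~ lattice tau (k%:R * eta).
Hypothesis z_generic : forall (i j : 'I_n) (l : int), i != j ->
  l \in [:: -1; 0; 1] -> ~ lattice tau (z i - (z j + 2 * eta * l%:~R)).

Definition site_point (s : 'I_n -> bool) : {ffun 'I_n -> C} :=
  [ffun k => if s k then - z k + eta else - z k - eta].

Lemma site_pointP s : sites eta z (site_point s).
Proof. by apply/forallP => k; rewrite ffunE; case: (s k); rewrite eqxx ?orbT. Qed.

(** Sites are indexed by sign patterns, so that a shift that stays inside the
    sites is the flip of one sign. *)
Definition site_of (s : 'I_n -> bool) : site eta z := exist _ (site_point s) (site_pointP s).

Lemma site_ofP (p : site eta z) : exists s, p = site_of s.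
Proof.
exists (fun k => val p k == - z k + eta); apply: val_inj; apply/ffunP => k /=.
rewrite ffunE; case: eqP => // ne.
by have /forallP/(_ k)/orP[/eqP//|/eqP] := valP p.
Qed.

Definition flip (i : 'I_n) (s : 'I_n -> bool) : 'I_n -> bool :=
  fun k => if k == i then ~~ s k else s k.

Lemma extend0_site (u : site eta z -> C) s : extend0 u (site_point s) = u (site_of s).
Proof.
rewrite /extend0 (insubT (sites eta z) (site_pointP s)).
by congr u; apply: val_inj.
Qed.

Lemma lattice_opp (g : C) : lattice tau g -> lattice tau (- g).
Proof.
move=> [r [s ->]]; exists (- r), (- s).
by rewrite !rmorphN /=; ring.
Qed.

Let coef (s : 'I_n -> bool) (i : 'I_n) : C :=
  if s i then \prod_k theta tau (z k - z i + 2 * eta)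
  else \prod_k theta tau (z k - z i - 2 * eta).

Let hop (u : site eta z -> C) (p : site eta z) (i : 'I_n) : C :=
  let x := val p in
  (\prod_k theta tau (x i + z k + eta)) * extend0 u (shift_coord i (- (2 * eta)) x)
  + (\prod_k theta tau (x i + z k - eta)) * extend0 u (shift_coord i (2 * eta) x).

(** Of the two shifts of the i-th coordinate one leaves the sites, and its
    coefficient contains the factor [theta 0]. *)
Lemma hop_site u s i : hop u (site_of s) i = coef s i * u (site_of (flip i s)).
Proof.
rewrite /hop /= /coef !ffunE; case si: (s i).
  rewrite [X in _ + X * _](bigD1 i) //= (_ : - z i + eta + z i - eta = 0); last by ring.
  rewrite theta0 // mul0r mul0r addr0 -extend0_site; congr (_ * extend0 u _).
    by apply: eq_bigr => k _; congr theta; ring.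
  apply/ffunP => k; rewrite !ffunE /flip; case: eqP => // ->.
  by rewrite si /=; ring.
rewrite [X in X * _ + _](bigD1 i) //= (_ : - z i - eta + z i + eta = 0); last by ring.
rewrite theta0 // mul0r mul0r add0r -extend0_site; congr (_ * extend0 u _).
  by apply: eq_bigr => k _; congr theta; ring.
apply/ffunP => k; rewrite !ffunE /flip; case: eqP => // ->.
by rewrite si /=; ring.
Qed.

Let lambda (s : 'I_n -> bool) : C := - \sum_k (site_point s k + z k).

(** [lambda] is an odd multiple of [eta], being a sum of an odd number of terms
    [eta] or [- eta]. *)
Lemma theta_lambda s : theta tau (lambda s) != 0.
Proof.
apply: theta_neq0 => //; rewrite /lambda.
have -> : \sum_k (site_point s k + z k) =
    (#|[pred k | s k]|%:R - #|[predC [pred k | s k]]|%:R) * eta.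
  rewrite (bigID s) /= (eq_bigr (fun=> eta)); last first.
    by move=> k sk; rewrite ffunE sk; ring.
  rewrite [X in _ + X](eq_bigr (fun=> - eta)); last first.
    by move=> k /negbTE sk; rewrite ffunE sk; ring.
  rewrite !sumr_const mulrBl !mulr_natl mulNrn; congr (_ *+ _ - _ *+ _);
    exact: eq_card.
have := cardC [pred k | s k]; rewrite card_ord.
set a := #|_|; set b := #|_| => abn latt.
have [ab|ba] := leqP b a.
  apply: (@eta_generic (a - b)%N); try lia.
  have := lattice_opp latt; rewrite opprK natrB //.
apply: (@eta_generic (b - a)%N); try lia.
by rewrite natrB ?(ltnW ba) // -opprB mulNr.
Qed.

Lemma theta_sub s i j : i != j -> theta tau (site_point s i - site_point s j) != 0.
Proof.
move=> ij; apply: theta_neq0 => //.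
pose l : int := (s i : nat)%:Z - (s j : nat)%:Z.
have l_in : l \in [:: -1; 0; 1] by rewrite /l; case: (s i); case: (s j).
move=> /lattice_opp; have := z_generic ij l_in.
suff -> : - (site_point s i - site_point s j) = z i - (z j + 2 * eta * l%:~R) by [].
by rewrite /l !ffunE; case: (s i); case: (s j);
  rewrite ?subrr ?subr0 ?sub0r ?mulr0z ?mulr1z ?mulrN1z; ring.
Qed.

(** The interpolation kernel [L_i] attached to a site. *)
Let kernel (s : 'I_n -> bool) (i : 'I_n) (w : C) : C :=
  let x := site_point s in
  theta tau (lambda s - - w + x i) / theta tau (lambda s)
    * (\prod_(j | j != i) (theta tau (- w - x j) / theta tau (x i - x j))).

Lemma transferE u s w :
  transfer tau w u (site_of s) = \sum_i kernel s i w * hop u (site_of s) i.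
Proof. by []. Qed.

Lemma kernel_delta s i j : kernel s i (- site_point s j) = (i == j)%:R.
Proof.
rewrite /kernel !opprK; have [<-|ij] := eqVneq i j.
  rewrite addrNK divff ?theta_lambda // mul1r big1 // => k ki.
  by rewrite divff // theta_sub // eq_sym.
by rewrite [X in _ * X](bigD1 j) 1?eq_sym //= subrr theta0 // mul0r mul0r mulr0.
Qed.

Let laws : (C -> C) -> Prop :=
  theta_space tau n ((-1) ^+ n * cexp (2 * pi%:C * 'i%C * \sum_j z j)).

Lemma laws_scale k f : laws f -> laws (fun w => k * f w).
Proof.
move=> [ef f1 ft]; split.
- exact: entireM (entire_cst k) ef.
- by move=> w; rewrite f1 mulrCA.
by move=> w; rewrite ft mulrCA.
Qed.

Lemma laws_sum (a : 'I_n -> C) (F : 'I_n -> C -> C) :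
  (forall i, laws (F i)) -> laws (fun w => \sum_i a i * F i w).
Proof.
move=> lF; split.
- apply: entire_sum => i _; have [eF _ _] := lF i; exact: entireM (entire_cst _) eF.
- move=> w; rewrite mulr_sumr; apply: eq_bigr => i _; have [_ F1 _] := lF i.
  by rewrite F1 mulrCA.
move=> w; rewrite mulr_sumr; apply: eq_bigr => i _; have [_ _ Ft] := lF i.
by rewrite Ft mulrCA.
Qed.

(** Up to a constant this is a product of [n] translates of theta, and the sum of
    the translations is [- sum_j z j]. *)
Lemma kernel_laws s i : laws (kernel s i).
Proof.
pose x := site_point s.
pose y j := if j == i then lambda s + x i else x j.
pose c := (theta tau (lambda s))^-1 * \prod_(j | j != i) (- (theta tau (x i - x j))^-1).
have kE : kernel s i = (fun w => c * \prod_j theta tau (w + y j)).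
  apply/funext => w; rewrite /kernel -/x /c [X in _ = _ * X](bigD1 i) //= {1}/y eqxx opprK.
  rewrite (_ : w + (lambda s + x i) = lambda s + w + x i); last by ring.
  rewrite (eq_bigr (fun j => (- (theta tau (x i - x j))^-1) * theta tau (w + y j))).
    by rewrite big_split /=; ring.
  move=> j ji; rewrite /y (negbTE ji) -opprD theta_odd //; ring.
have sum_y : \sum_j y j = - \sum_j z j.
  rewrite (bigD1 i) //= {1}/y eqxx (eq_bigr x); last by move=> j /negbTE; rewrite /y => ->.
  have E : \sum_j x j = x i + \sum_(j | j != i) x j by rewrite (bigD1 i).
  by rewrite -addrA -E /lambda big_split /= opprD addrAC addNr add0r.
have := theta_prod_space tau_gt0 y; rewrite sum_y mulrN opprK kE.
exact: laws_scale.
Qed.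

Lemma flipK i s : flip i (flip i s) = s.
Proof. by apply/funext => k; rewrite /flip; case: eqP => // _; rewrite negbK. Qed.

Lemma flipE i s : flip i s i = ~~ s i.
Proof. by rewrite /flip eqxx. Qed.

Lemma site_pointE s i : - site_point s i = if s i then z i - eta else z i + eta.
Proof. by rewrite ffunE; case: (s i); ring. Qed.

Lemma eigenvalue_at_site eps u s i :
  (forall w p, transfer tau w u p = eps w * u p) ->
  eps (- site_point s i) * u (site_of s) = coef s i * u (site_of (flip i s)).
Proof.
move=> eig; rewrite -eig transferE (bigD1 i) //= kernel_delta eqxx mul1r hop_site.
rewrite big1 ?addr0 // => j ji.
by rewrite kernel_delta (negbTE ji) mul0r.
Qed.

Lemma quadratic_relation eps i : common_eigenvalue tau eta z eps ->
  eps (z i - eta) * eps (z i + eta) =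
  \prod_k (theta tau (z k - z i + 2 * eta) * theta tau (z k - z i - 2 * eta)).
Proof.
move=> [u [p up0] eig]; have [s pE] := site_ofP p; rewrite big_split /=.
have := eigenvalue_at_site s i eig; have := eigenvalue_at_site (flip i s) i eig.
rewrite flipK !site_pointE /coef flipE -pE; set v := u (site_of _).
by case: (s i) => /= E1 E2; apply: (mulIf up0);
  [rewrite mulrAC E2 -mulrA [v * _]mulrC E1; ring
  |rewrite -mulrA E2 mulrCA E1; ring].
Qed.

Lemma eigenvalue_laws eps : common_eigenvalue tau eta z eps -> laws eps.
Proof.
move=> [u [p up0] eig]; have [s pE] := site_ofP p.
have -> : eps = (fun w => \sum_i (hop u p i / u p) * kernel s i w).
  apply/funext => w; apply: (mulIf up0); rewrite -eig {1}pE transferE mulr_suml -pE.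
  by apply: eq_bigr => i _; field.
by apply: laws_sum => i; exact: kernel_laws.
Qed.

(** The eigenvector is the product over [i] of kernel vectors of the 2 x 2
    systems satisfied by the values at neighbouring sites. *)
Lemma eigenvalueP eps : laws eps ->
  (forall i, eps (z i - eta) * eps (z i + eta) =
    \prod_k (theta tau (z k - z i + 2 * eta) * theta tau (z k - z i - 2 * eta))) ->
  common_eigenvalue tau eta z eps.
Proof.
move=> leps quad.
pose a i := \prod_k theta tau (z k - z i + 2 * eta).
pose b i := \prod_k theta tau (z k - z i - 2 * eta).
(* The quadratic relation is the vanishing of a 2 x 2 determinant. *)
have [v vP] : {v : 'I_n -> C * C & forall i,
    [/\ eps (z i - eta) * (v i).1 = a i * (v i).2,
        eps (z i + eta) * (v i).2 = b i * (v i).1 & v i != 0]}.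
  apply: (@choice _ _ (fun i w => [/\ eps (z i - eta) * w.1 = a i * w.2,
     eps (z i + eta) * w.2 = b i * w.1 & w != 0])) => i.
  have := quad i; rewrite big_split /= -/(a i) -/(b i).
  set e1 := eps _; set e2 := eps _ => det.
  have [/andP[/eqP a0 /eqP e10]|ne] := boolP ((a i == 0) && (e1 == 0)); last first.
    by exists (a i, e1); split=> //=; [rewrite mulrC|rewrite mulrC det mulrC].
  have [/andP[/eqP e20 /eqP b0]|ne] := boolP ((e2 == 0) && (b i == 0)); last first.
    by exists (e2, b i); split=> //=; rewrite mulrC.
  exists (1, 0); split=> /=; rewrite ?e10 ?a0 ?e20 ?b0 ?mul0r ?mulr0 //.
  by rewrite -[_ == _]/((1 == 0 :> C) && (0 == 0 :> C)) oner_eq0.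
have eta0 : eta != 0.
  apply/eqP => eta0; apply: (@eta_generic 1 isT); first by case: (n) n_odd.
  by exists 0, 0; rewrite eta0 mulr0 mul0r addr0.
have point_inj s i : (site_point s i == - z i + eta) = s i.
  rewrite ffunE; case: (s i); first exact: eqxx.
  apply/negbTE; rewrite (inj_eq (addrI _)) eq_sym -subr_eq0 opprK -mulr2n.
  by rewrite mulrn_eq0.
pose u (p : site eta z) := \prod_i (if val p i == - z i + eta then (v i).1 else (v i).2).
have uE s : u (site_of s) = \prod_i (if s i then (v i).1 else (v i).2).
  by apply: eq_bigr => i _; rewrite point_inj.
exists u.
  exists (site_of (fun i => (v i).1 != 0)); rewrite uE; apply/prodf_neq0 => i _.
  case: (v i) (vP i) => x y [_ _ /=]; have [->|//] := eqVneq x 0.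
  by apply: contra => /eqP ->; exact: eqxx.
move=> w p; have [s ->] := site_ofP p; rewrite transferE.
have B0 : (-1) ^+ n * cexp (2 * pi%:C * 'i%C * \sum_j z j) != 0 :> C.
  by rewrite mulf_neq0 ?cexp_neq0 // signr_eq0.
have -> := theta_interpolation n_odd B0 (kernel_laws s) leps
  (x := fun i => - site_point s i) (fun i j => kernel_delta s i j) w.
rewrite mulr_suml; apply: eq_bigr => i _.
have -> : hop u (site_of s) i = eps (- site_point s i) * u (site_of s).
  rewrite hop_site !uE [X in _ * X](bigD1 i) //= [in RHS](bigD1 i) //= !mulrA.
  congr (_ * _); last by apply: eq_bigr => j ji; rewrite /flip (negbTE ji).
  rewrite site_pointE /coef flipE; have [E1 E2 _] := vP i.
  by case: (s i).
by rewrite mulrCA mulrA.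
Qed.

(** A character with the given values at 1 and [tau] is obtained by extending its
    logarithm linearly in the real coordinates along 1 and [tau]. *)
Lemma Theta_chiP eps :
  (exists chi : C -> C, [/\ is_character tau chi, chi 1 = (-1) ^+ n,
    chi tau = (-1) ^+ n * cexp (2 * pi%:C * 'i%C * \sum_j z j) &
    Theta tau n chi eps]) <-> laws eps.
Proof.
split=> [[chi [_ chi1 chitau [eeps Teps]]]|[eeps e1 et]].
  split=> // w.
    have := Teps 1 0 w; rewrite [X in cexp X](_ : _ = 0); last by rewrite mulr0z; ring.
    by rewrite mulr1z mulr0z mul0r !addr0 chi1 cexp0 mulr1.
  have := Teps 0 1 w; rewrite mulr1z mulr0z mul1r !add0r addr0 chitau => ->.
  by congr (_ * _ * _); rewrite /automorphy; congr cexp; ring.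
have tau0 : complex.Im tau != 0 by rewrite gt_eqF.
pose s (g : C) := complex.Im g / complex.Im tau.
pose r (g : C) := complex.Re g - s g * complex.Re tau.
pose a : C := 'i%C * pi%:C * n%:R.
pose b : C := 'i%C * pi%:C * n%:R + 2 * pi%:C * 'i%C * \sum_j z j.
pose chi (g : C) := cexp ((r g)%:C * a + (s g)%:C * b).
have cexp_a : cexp a = (-1) ^+ n by rewrite /a mulrC cexpMn cexp_pi.
have cexp_b : cexp b = (-1) ^+ n * cexp (2 * pi%:C * 'i%C * \sum_j z j).
  by rewrite /b cexpD cexp_a.
have chiE (m k : int) : chi (m%:~R + k%:~R * tau) = cexp (m%:~R * a + k%:~R * b).
  have sE : s (m%:~R + k%:~R * tau) = k%:~R.
    rewrite /s raddfD /= -!(rmorph_int (real_complex R)) ImZ /= add0r mulfK //.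
  have rE : r (m%:~R + k%:~R * tau) = m%:~R.
    by rewrite /r sE raddfD /= -!(rmorph_int (real_complex R)) ReZ /= addrK.
  by rewrite /chi sE rE !rmorph_int.
exists chi; split.
- split=> [g _|g h _ _]; first exact: cexp_neq0.
  rewrite /chi -cexpD; congr cexp.
  have -> : s (g + h) = s g + s h by rewrite /s raddfD mulrDl.
  have -> : r (g + h) = r g + r h by rewrite /r /s !raddfD /= mulrDl; ring.
  by rewrite !rmorphD /=; ring.
- have := chiE 1 0; rewrite mulr1z mulr0z mul0r mul1r mul0r !addr0 => ->; exact: cexp_a.
- have := chiE 0 1; rewrite mulr1z mulr0z mul0r !mul1r !add0r => ->; exact: cexp_b.
split=> // m k w; rewrite chiE.
by apply: Theta_of_generators => // x; rewrite ?cexp_a ?cexp_b.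
Qed.

Lemma eigenvalue_characterization eps : common_eigenvalue tau eta z eps <->
  (exists chi : C -> C, [/\ is_character tau chi, chi 1 = (-1) ^+ n,
    chi tau = (-1) ^+ n * cexp (2 * pi%:C * 'i%C * \sum_j z j) &
    Theta tau n chi eps]) /\
  (forall i, eps (z i - eta) * eps (z i + eta) =
    \prod_k (theta tau (z k - z i + 2 * eta) * theta tau (z k - z i - 2 * eta))).
Proof.
split=> [ev|[/Theta_chiP leps quad]]; last exact: eigenvalueP.
split=> [|i]; last exact: quadratic_relation.
by apply/Theta_chiP; exact: eigenvalue_laws.
Qed.

End Sites.

(** * Common eigenvalues of the transfer matrices *)

Theorem theorem4p2 (R : realType) (tau eta : R[i]) (n : nat)
    (z : 'I_n -> R[i])
    (tau_gt0 : 0 < complex.Im tau)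
    (n_odd : odd n)
    (eta_generic : forall k : nat, odd k -> (1 <= k <= n)%N ->
       ~ lattice tau (k%:R * eta))
    (z_generic : forall (i j : 'I_n) (l : int), i != j ->
       l \in [:: -1; 0; 1] -> ~ lattice tau (z i - (z j + 2 * eta * l%:~R)))
    (eps : R[i] -> R[i]) :
  common_eigenvalue tau eta z eps <->
  (exists chi : R[i] -> R[i],
     [/\ is_character tau chi,
         chi 1 = (-1) ^+ n,
         chi tau = (-1) ^+ n * cexp (2 * pi%:C * 'i%C * \sum_j z j) &
         Theta tau n chi eps]) /\
  (forall i : 'I_n,
     eps (z i - eta) * eps (z i + eta) =
     \prod_k (theta tau (z k - z i + 2 * eta) * theta tau (z k - z i - 2 * eta))).
Proof. exact: eigenvalue_characterization. Qed.
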